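(* Let $p\ge 2$ and let $f=u+iv$ be a holomorphic function on the unit disk $\mathbf{U}$ (with $u=\Re f$ and $v=\Im f$) such that $f(0)=0$ and $f\in H^p$. Then for $p\in[2,4]$, $$\|f\|_{H^p}\le \left(\frac{p}{p-1}\right)^{1/p}\left(\|u\|_{h^p}^p+\|v\|_{h^p}^p\right)^{1/p},$$ and for $p\ge 4$, $$\|f\|_{H^p}\ge \left(\frac{p}{p-1}\right)^{1/p}\left(\|u\|_{h^p}^p+\|v\|_{h^p}^p\right)^{1/p}.$$
   Context: $\mathbf{U}=\{z\in\mathbb{C}:|z|<1\}$. For a (real- or complex-valued) harmonic function $g$ on $\mathbf{U}$, $\|g\|_{h^p}=\sup_{0\le r<1}\left(\frac{1}{2\pi}\int_0^{2\pi}|g(re^{it})|^p\,dt\right)^{1/p}$. For holomorphic $g$ the same quantity is denoted $\|g\|_{H^p}$, and $H^p$ is the space of holomorphic functions $g$ on $\mathbf{U}$ with $\|g\|_{H^p}<\infty$. *)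

(* Defs.v *)
From Stdlib Require Import Reals.
From Coquelicot Require Import Coquelicot.

Open Scope R_scope.

(* Complex differentiability: the scalar field is C, not R. *)
Definition holomorphic_on_disk (f : C -> C) : Prop :=
  forall z : C, Cmod z < 1 -> @ex_derive C_AbsRing C_NormedModule f z.

(* Real power of a nonnegative base with positive exponent.  [Rpower] alone
   does not do, since [Rpower 0 a = 1].  Only bases [x >= 0] are meaningful. *)
Definition powR (x a : R) : R := if Rle_dec x 0 then 0 else Rpower x a.

(* The same on [0, +oo]; the value at [m_infty] is a dummy. *)
Definition Rbar_powR (x : Rbar) (a : R) : Rbar :=
  match x with
  | Finite r => Finite (powR r a)
  | p_infty => p_infty
  | m_infty => Finite 0
  end.

Definition polar (r t : R) : C := (r * cos t, r * sin t).

Definition integral_mean (p : R) (g : C -> C) (r : R) : R :=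
  powR (/ (2 * PI) * RInt (fun t => powR (Cmod (g (polar r t))) p) 0 (2 * PI))
       (1 / p).

(* For g continuous on the disk (in particular harmonic or holomorphic) the
   integrands above are continuous, so the Riemann integrals are genuine.
   A real-valued g is handled through the embedding [RtoC]. *)
Definition hp_norm (p : R) (g : C -> C) : Rbar :=
  Lub_Rbar (fun x : R => exists r : R, 0 <= r < 1 /\ x = integral_mean p g r).

Definition Hardy (p : R) (f : C -> C) : Prop :=
  holomorphic_on_disk f /\ Rbar_lt (hp_norm p f) p_infty.

(* Main.v *)
(** Put g(s + it) = f(exp(s + it)) = U + iV on the half-plane s < 0.  If
    Phi(x, y) is C^2 and has nonnegative Laplacian, then the Laplacian of
    Phi(g) is |g'|^2 (Lap Phi)(g), so its mean over 0 <= t <= 2 pi is convex in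
    s; being bounded as s -> -oo, the mean is nondecreasing.  With c = p/(p-1),
    c (|x|^p + |y|^p) - |x + iy|^p has Laplacian
    p^2 (|x|^(p-2) + |y|^(p-2) - |x + iy|^(p-2)), which is >= 0 for p <= 4 and
    <= 0 for p >= 4, and the mean tends to 0 as s -> -oo because f(0) = 0.

    Two regularisations make this rigorous.  As f is only assumed complex
    differentiable, g is replaced by its iterated average over [s - h, s];
    Goursat's theorem shows that this average is holomorphic, its derivative
    being a difference quotient of g.  The powers are replaced by
    (a x^2 + b y^2 + e)^k with k = p/2, which are smooth at the zeros. *)

Require Import Defs.
From Stdlib Require Import Reals Lra Psatz.
From Coquelicot Require Import Coquelicot.

(** * Goursat's theorem on rectangles *)

(** The constant comes from two Laplacians: |x|^p has p (p-1) |x|^(p-2), |x + iy|^p has p^2 |x +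
    iy|^(p-2), and c = p/(p-1) equalises the coefficients. What remains compares the power m = p/2 -
    1 of a sum of squares with the powers of its terms; p = 4 is m = 1, where subadditivity turns
    into superadditivity. The smoothing has to keep holomorphy, the period in t and the half-plane;
    averaging backwards in s alone keeps all three. Its t-derivative cannot be taken under the
    integral, as the partial derivatives of g are not known to be continuous; a vanishing rectangle
    integral supplies it. The second average is there to make the second derivatives continuous.
    Adding constants to the squares disturbs the inequality between the Laplacians, so the constants
    of the radial and the axial powers are matched, differently for p <= 4 and p >= 4. For p >= 4
    the norms of u and v are separate suprema; their powers can be added under one bound because
    each mean is itself nondecreasing in the radius. *)

Lemma continuity_2d_pt_continuous_1 (f : R -> R -> R) (x y : R) :
  continuity_2d_pt f x y -> continuous (fun s => f s y) x.
Proof.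
  intros H. apply continuity_pt_filterlim. intros eps Heps.
  destruct (H (mkposreal eps Heps)) as [d Hd].
  exists d. split. { apply cond_pos. }
  intros u [_ Hu]. apply Hd. exact Hu.
  rewrite Rminus_diag, Rabs_R0. apply cond_pos.
Qed.

Lemma continuity_2d_pt_continuous_2 (f : R -> R -> R) (x y : R) :
  continuity_2d_pt f x y -> continuous (fun t => f x t) y.
Proof.
  intros H. apply continuity_pt_filterlim. intros eps Heps.
  destruct (H (mkposreal eps Heps)) as [d Hd].
  exists d. split. { apply cond_pos. }
  intros u [_ Hu]. apply Hd. 2: exact Hu.
  rewrite Rminus_diag, Rabs_R0. apply cond_pos.
Qed.

(** The integral of [P ds + Q dt] counterclockwise round the boundary of [a, b] x [c, d]. Opposite
    sides share one integral, so that on a small rectangle each difference can be estimated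
    directly. *)
Definition circulation (P Q : R -> R -> R) (a b c d : R) : R :=
  RInt (fun s => P s c - P s d) a b + RInt (fun t => Q b t - Q a t) c d.

Definition continuous_on_rect (P : R -> R -> R) (a b c d : R) : Prop :=
  forall s t, a <= s <= b -> c <= t <= d -> continuity_2d_pt P s t.

Lemma ex_RInt_rect_1 P a b c d a' b' t :
  continuous_on_rect P a b c d -> a <= a' -> a' <= b' -> b' <= b ->
  c <= t <= d -> ex_RInt (fun s => P s t) a' b'.
Proof.
  intros HP H1 H2 H3 Ht. apply (@ex_RInt_continuous R_CompleteNormedModule).
  intros z Hz. rewrite Rmin_left, Rmax_right in Hz by lra.
  apply (continuity_2d_pt_continuous_1 P). apply HP; lra.
Qed.

Lemma ex_RInt_rect_2 P a b c d c' d' s :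
  continuous_on_rect P a b c d -> c <= c' -> c' <= d' -> d' <= d ->
  a <= s <= b -> ex_RInt (fun t => P s t) c' d'.
Proof.
  intros HP H1 H2 H3 Ht. apply (@ex_RInt_continuous R_CompleteNormedModule).
  intros z Hz. rewrite Rmin_left, Rmax_right in Hz by lra.
  apply (continuity_2d_pt_continuous_2 P). apply HP; lra.
Qed.

Lemma RInt_minus_R (f g : R -> R) a b :
  ex_RInt f a b -> ex_RInt g a b ->
  RInt (fun x => f x - g x) a b = RInt f a b - RInt g a b.
Proof. exact (RInt_minus (V := R_CompleteNormedModule) f g a b). Qed.

Lemma RInt_Chasles_R (f : R -> R) a b c :
  ex_RInt f a b -> ex_RInt f b c -> RInt f a c = RInt f a b + RInt f b c.
Proof. intros. symmetry. exact (RInt_Chasles (V := R_CompleteNormedModule) f a b c H H0). Qed.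

Lemma circulation_expand P Q a b c d :
  ex_RInt (fun s => P s c) a b -> ex_RInt (fun s => P s d) a b ->
  ex_RInt (fun t => Q b t) c d -> ex_RInt (fun t => Q a t) c d ->
  circulation P Q a b c d =
    RInt (fun s => P s c) a b - RInt (fun s => P s d) a b +
    (RInt (fun t => Q b t) c d - RInt (fun t => Q a t) c d).
Proof.
  intros. unfold circulation.
  rewrite (RInt_minus_R (fun s => P s c) (fun s => P s d)) by assumption.
  now rewrite (RInt_minus_R (fun t => Q b t) (fun t => Q a t)).
Qed.

(** The four inner segments are each traversed twice in opposite directions and cancel. *)
Lemma circulation_quarter P Q a b c d :
  a < b -> c < d ->
  continuous_on_rect P a b c d -> continuous_on_rect Q a b c d ->
  let m := (a + b) / 2 in let n := (c + d) / 2 in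
  circulation P Q a b c d =
    circulation P Q a m c n + circulation P Q m b c n +
    (circulation P Q a m n d + circulation P Q m b n d).
Proof.
  intros Hab Hcd HP HQ m n.
  assert (Hm : a < m < b) by (unfold m; lra).
  assert (Hn : c < n < d) by (unfold n; lra).
  assert (E1 : forall t a' b', c <= t <= d -> a <= a' -> a' <= b' -> b' <= b ->
     ex_RInt (fun s => P s t) a' b') by (intros; eapply ex_RInt_rect_1; eauto).
  assert (E2 : forall s a' b', a <= s <= b -> c <= a' -> a' <= b' -> b' <= d ->
     ex_RInt (fun t => Q s t) a' b') by (intros; eapply ex_RInt_rect_2; eauto).
  clearbody m n.
  rewrite (circulation_expand P Q a b c d); [ | apply E1; lra | apply E1; lra | apply E2; lra | apply E2; lra].
  rewrite (circulation_expand P Q a m c n); [ | apply E1; lra | apply E1; lra | apply E2; lra | apply E2; lra].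
  rewrite (circulation_expand P Q m b c n); [ | apply E1; lra | apply E1; lra | apply E2; lra | apply E2; lra].
  rewrite (circulation_expand P Q a m n d); [ | apply E1; lra | apply E1; lra | apply E2; lra | apply E2; lra].
  rewrite (circulation_expand P Q m b n d); [ | apply E1; lra | apply E1; lra | apply E2; lra | apply E2; lra].
  rewrite (RInt_Chasles_R (fun s => P s c) a m b) by (apply E1; lra).
  rewrite (RInt_Chasles_R (fun s => P s d) a m b) by (apply E1; lra).
  rewrite (RInt_Chasles_R (fun t => Q a t) c n d) by (apply E2; lra).
  rewrite (RInt_Chasles_R (fun t => Q b t) c n d) by (apply E2; lra).
  lra.
Qed.

(** If all four quarters fell below a quarter of the total, the triangle inequality would contradict
    [circulation_quarter]. The conclusion is informative so that the choice can be iterated by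
    recursion; a corner determines the quarter, since its sides are halves of the given ones. *)
Lemma circulation_bisect P Q a b c d :
  a < b -> c < d ->
  continuous_on_rect P a b c d -> continuous_on_rect Q a b c d ->
  { q : (R * R) | let (a', c') := q in
      a <= a' /\ a' + (b - a) / 2 <= b /\ c <= c' /\ c' + (d - c) / 2 <= d /\
      Rabs (circulation P Q a b c d) / 4 <=
      Rabs (circulation P Q a' (a' + (b - a) / 2) c' (c' + (d - c) / 2)) }.
Proof.
  intros Hab Hcd HP HQ.
  pose proof (circulation_quarter P Q a b c d Hab Hcd HP HQ) as E. cbv zeta in E.
  set (m := (a + b) / 2) in *. set (n := (c + d) / 2) in *.
  set (T := Rabs (circulation P Q a b c d) / 4).
  assert (Em : a + (b - a) / 2 = m) by (unfold m; field).
  assert (Eb : m + (b - a) / 2 = b) by (unfold m; field).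
  assert (En : c + (d - c) / 2 = n) by (unfold n; field).
  assert (Ed : n + (d - c) / 2 = d) by (unfold n; field).
  destruct (Rle_dec T (Rabs (circulation P Q a m c n))) as [H1 | H1].
  { exists (a, c). rewrite Em, En. fold T. repeat split; try exact H1; lra. }
  destruct (Rle_dec T (Rabs (circulation P Q m b c n))) as [H2 | H2].
  { exists (m, c). rewrite Eb, En. fold T. repeat split; try exact H2; lra. }
  destruct (Rle_dec T (Rabs (circulation P Q a m n d))) as [H3 | H3].
  { exists (a, n). rewrite Em, Ed. fold T. repeat split; try exact H3; lra. }
  exists (m, n). rewrite Eb, Ed. fold T. repeat split; try lra.
  assert (HT : 4 * T = Rabs (circulation P Q a b c d)) by (unfold T; field).
  rewrite E in HT.
  pose proof (Rabs_triang (circulation P Q a m c n + circulation P Q m b c n)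
    (circulation P Q a m n d + circulation P Q m b n d)).
  pose proof (Rabs_triang (circulation P Q a m c n) (circulation P Q m b c n)).
  pose proof (Rabs_triang (circulation P Q a m n d) (circulation P Q m b n d)).
  lra.
Qed.

Lemma differentiable_pt_lim_continuity f x y lx ly :
  differentiable_pt_lim f x y lx ly -> continuity_2d_pt f x y.
Proof. intros H. apply differentiable_continuity_pt. now exists lx, ly. Qed.

Lemma continuous_on_rect_sub P a b c d a' b' c' d' :
  a <= a' -> b' <= b -> c <= c' -> d' <= d ->
  continuous_on_rect P a b c d -> continuous_on_rect P a' b' c' d'.
Proof. intros ? ? ? ? H s t ? ?. apply H; lra. Qed.

(* The linear parts of [P] and [Q] contribute [(Q_s - P_t) * area = 0]. *)
Lemma circulation_local P Q x y px k qy :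
  differentiable_pt_lim P x y px k -> differentiable_pt_lim Q x y k qy ->
  forall eta, 0 < eta -> exists delta, 0 < delta /\
  forall a l c h, 0 < l -> 0 < h -> l + h < delta ->
    a <= x <= a + l -> c <= y <= c + h ->
    continuous_on_rect P a (a + l) c (c + h) ->
    continuous_on_rect Q a (a + l) c (c + h) ->
    Rabs (circulation P Q a (a + l) c (c + h)) <= eta * (l + h) ^ 2.
Proof.
  intros HP HQ eta Heta.
  assert (He : 0 < eta / 2) by lra.
  destruct (HP (mkposreal _ He)) as [d1 H1]. destruct (HQ (mkposreal _ He)) as [d2 H2].
  simpl in H1, H2.
  exists (Rmin d1 d2). split. { apply Rmin_glb_lt; apply cond_pos. }
  intros a l c h Hl Hh Hs Hx Hy CP CQ.
  pose proof (Rmin_l d1 d2). pose proof (Rmin_r d1 d2).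
  assert (B1 : forall s t, a <= s <= a + l -> c <= t <= c + h ->
     Rabs (P s t - P x y - (px * (s - x) + k * (t - y))) <= eta / 2 * (l + h) /\
     Rabs (Q s t - Q x y - (k * (s - x) + qy * (t - y))) <= eta / 2 * (l + h)).
  { intros s t Hs' Ht'.
    assert (Rabs (s - x) <= l) by (apply Rabs_le; lra).
    assert (Rabs (t - y) <= h) by (apply Rabs_le; lra).
    assert (Rmax (Rabs (s - x)) (Rabs (t - y)) <= l + h) by (apply Rmax_lub; lra).
    split; (eapply Rle_trans; [apply H1 || apply H2; lra |]);
    apply Rmult_le_compat_l; lra. }
  unfold circulation.
  assert (X1 : ex_RInt (fun s => P s c - P s (c + h)) a (a + l)).
  { apply (ex_RInt_minus (V := R_NormedModule));
    eapply ex_RInt_rect_1; try exact CP; lra. }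
  assert (X2 : ex_RInt (fun t => Q (a + l) t - Q a t) c (c + h)).
  { apply (ex_RInt_minus (V := R_NormedModule));
    eapply ex_RInt_rect_2; try exact CQ; lra. }
  assert (K1 : Rabs (RInt (fun s => (P s c - P s (c + h)) - (- k * h)) a (a + l))
     <= (a + l - a) * (eta * (l + h))).
  { apply abs_RInt_le_const. lra.
    apply (ex_RInt_minus (V := R_NormedModule)). exact X1. apply ex_RInt_const.
    intros s Hs'. destruct (B1 s c ltac:(lra) ltac:(lra)) as [U1 _].
    destruct (B1 s (c + h) ltac:(lra) ltac:(lra)) as [U2 _].
    apply Rabs_le_between in U1. apply Rabs_le_between in U2. apply Rabs_le. lra. }
  assert (K2 : Rabs (RInt (fun t => (Q (a + l) t - Q a t) - (k * l)) c (c + h))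
     <= (c + h - c) * (eta * (l + h))).
  { apply abs_RInt_le_const. lra.
    apply (ex_RInt_minus (V := R_NormedModule)). exact X2. apply ex_RInt_const.
    intros t Ht'. destruct (B1 (a + l) t ltac:(lra) ltac:(lra)) as [_ U1].
    destruct (B1 a t ltac:(lra) ltac:(lra)) as [_ U2].
    apply Rabs_le_between in U1. apply Rabs_le_between in U2. apply Rabs_le. lra. }
  rewrite (RInt_minus_R (fun s => P s c - P s (c + h))) in K1 by (exact X1 || apply ex_RInt_const).
  rewrite (RInt_minus_R (fun t => Q (a + l) t - Q a t)) in K2 by (exact X2 || apply ex_RInt_const).
  rewrite RInt_const in K1, K2.
  change (scal (a + l - a) (- k * h)) with ((a + l - a) * (- k * h)) in K1.
  change (scal (c + h - c) (k * l)) with ((c + h - c) * (k * l)) in K2.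
  apply Rabs_le_between in K1. apply Rabs_le_between in K2. apply Rabs_le. nra.
Qed.

(** Bisection gives nested rectangles shrinking to a point. The [n]-th one carries at least [4 ^ -n]
    of the circulation, while differentiability at the limit point bounds its circulation by an
    arbitrarily small multiple of its squared size, which also scales like [4 ^ -n]. The shared [k]
    says that [P ds + Q dt] is closed. *)
Lemma goursat_rectangle P Q (px k qy : R -> R -> R) a b c d :
  a < b -> c < d ->
  (forall s t, a <= s <= b -> c <= t <= d ->
     differentiable_pt_lim P s t (px s t) (k s t) /\
     differentiable_pt_lim Q s t (k s t) (qy s t)) ->
  circulation P Q a b c d = 0.
Proof.
  intros Hab Hcd HD.
  assert (CP : continuous_on_rect P a b c d).
  { intros s t Hs Ht. eapply differentiable_pt_lim_continuity, HD; auto. }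
  assert (CQ : continuous_on_rect Q a b c d).
  { intros s t Hs Ht. eapply differentiable_pt_lim_continuity, HD; auto. }
  set (l := fun n : nat => (b - a) / 2 ^ n). set (h := fun n : nat => (d - c) / 2 ^ n).
  assert (P2 : forall n : nat, 0 < 2 ^ n) by (intros; apply pow_lt; lra).
  assert (Hl : forall n, 0 < l n) by (intros; apply Rdiv_lt_0_compat; auto; lra).
  assert (Hh : forall n, 0 < h n) by (intros; apply Rdiv_lt_0_compat; auto; lra).
  assert (Sl : forall n, l (S n) = l n / 2).
  { intros n. unfold l. simpl. specialize (P2 n). field. lra. }
  assert (Sh : forall n, h (S n) = h n / 2).
  { intros n. unfold h. simpl. specialize (P2 n). field. lra. }
  set (ok := fun n (q : R * R) =>
     a <= fst q /\ fst q + l n <= b /\ c <= snd q /\ snd q + h n <= d).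
  assert (step : forall n (q : R * R), ok n q -> { q' | ok (S n) q' /\
      fst q <= fst q' /\ fst q' + l (S n) <= fst q + l n /\
      snd q <= snd q' /\ snd q' + h (S n) <= snd q + h n /\
      Rabs (circulation P Q (fst q) (fst q + l n) (snd q) (snd q + h n)) / 4 <=
      Rabs (circulation P Q (fst q') (fst q' + l (S n)) (snd q') (snd q' + h (S n)))}).
  { intros n [a0 c0] (O1 & O2 & O3 & O4). simpl in *.
    pose proof (Hl n). pose proof (Hh n).
    destruct (circulation_bisect P Q a0 (a0 + l n) c0 (c0 + h n)) as [[a1 c1] HH].
    lra. lra.
    eapply continuous_on_rect_sub; [ | | | | exact CP]; lra.
    eapply continuous_on_rect_sub; [ | | | | exact CQ]; lra.
    replace ((a0 + l n - a0) / 2) with (l (S n)) in HH by (rewrite Sl; field).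
    replace ((c0 + h n - c0) / 2) with (h (S n)) in HH by (rewrite Sh; field).
    exists (a1, c1). unfold ok. simpl. intuition lra. }
  assert (ok0 : ok O (a, c)).
  { unfold ok, l, h. simpl. repeat split; lra. }
  (* Each corner carries its proof of [ok], because [step] applies only to rectangles inside the
     original one. *)
  set (seq := fix seq (n : nat) : { q | ok n q } :=
     match n with
     | O => exist _ (a, c) ok0
     | S m => let (q, Hq) := seq m in
              let (q', Hq') := step m q Hq in exist _ q' (proj1 Hq')
     end).
  set (A := fun n => fst (proj1_sig (seq n))). set (C0 := fun n => snd (proj1_sig (seq n))).
  assert (Hok : forall n, a <= A n /\ A n + l n <= b /\ c <= C0 n /\ C0 n + h n <= d)
    by (intros n; exact (proj2_sig (seq n))).
  set (E := fun n => Rabs (circulation P Q (A n) (A n + l n) (C0 n) (C0 n + h n))).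
  assert (Hst : forall n, A n <= A (S n) /\ A (S n) + l (S n) <= A n + l n /\
      C0 n <= C0 (S n) /\ C0 (S n) + h (S n) <= C0 n + h n /\ E n / 4 <= E (S n)).
  { intros n. unfold E, A, C0. simpl. destruct (seq n) as [q Hq].
    destruct (step n q Hq) as [q' Hq']. simpl. tauto. }
  assert (HE : forall n, E O <= 4 ^ n * E n).
  { induction n as [|n IH]. simpl; lra. destruct (Hst n) as (_ & _ & _ & _ & H).
    assert (0 < 4 ^ n) by (apply pow_lt; lra). simpl. nra. }
  assert (mono : forall n m, A n <= A (n + m)%nat /\ A (n + m)%nat + l (n + m)%nat <= A n + l n
    /\ C0 n <= C0 (n + m)%nat /\ C0 (n + m)%nat + h (n + m)%nat <= C0 n + h n).
  { intros n. induction m as [|m IH]. rewrite Nat.add_0_r; lra.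
    rewrite Nat.add_succ_r. destruct (Hst (n + m)%nat). lra. }
  assert (nest : forall n, forall m, A m <= A n + l n /\ C0 m <= C0 n + h n).
  { intros n m. destruct (Nat.le_ge_cases n m) as [Hnm|Hnm].
    - destruct (mono n (m - n)%nat) as (_ & M1 & _ & M2).
      replace (n + (m - n))%nat with m in M1, M2 by lia.
      pose proof (Hl m). pose proof (Hh m). lra.
    - destruct (mono m (n - m)%nat) as (M1 & _ & M2 & _).
      replace (m + (n - m))%nat with n in M1, M2 by lia.
      pose proof (Hl n). pose proof (Hh n). lra. }
  assert (HX : exists x, forall n, A n <= x <= A n + l n).
  { destruct (completeness (fun y => exists n, y = A n)) as [x [Hx1 Hx2]].
    - exists (A O + l O). intros y [n ->]. apply nest.
    - exists (A O). now exists O.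
    - exists x. intros n. split. apply Hx1; now exists n.
      apply Hx2. intros y [m ->]. apply nest. }
  assert (HY : exists x, forall n, C0 n <= x <= C0 n + h n).
  { destruct (completeness (fun y => exists n, y = C0 n)) as [x [Hx1 Hx2]].
    - exists (C0 O + h O). intros y [n ->]. apply nest.
    - exists (C0 O). now exists O.
    - exists x. intros n. split. apply Hx1; now exists n.
      apply Hx2. intros y [m ->]. apply nest. }
  destruct HX as [x Hx]. destruct HY as [y Hy].
  (* Half the perimeter: [l n + h n = D / 2 ^ n], so the factor [4 ^ n] of [HE] cancels against
     [(l n + h n) ^ 2]. *)
  set (D := (b - a) + (d - c)). assert (HDp : 0 < D) by (unfold D; lra).
  assert (small : forall eta, 0 < eta -> E O <= eta * D ^ 2).
  { intros eta Heta.
    destruct (HD x y) as [D1 D2].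
    { specialize (Hx O). specialize (Hok O). lra. }
    { specialize (Hy O). specialize (Hok O). lra. }
    destruct (circulation_local P Q x y _ _ _ D1 D2 eta Heta) as [delta [Hd HL]].
    destruct (pow_lt_1_zero (/ 2) ltac:(rewrite Rabs_right; lra) (delta / D)) as [n Hn].
    { apply Rdiv_lt_0_compat; lra. }
    specialize (Hn n (Nat.le_refl n)).
    rewrite pow_inv, Rabs_right in Hn by (left; apply Rinv_0_lt_compat, P2).
    assert (El : l n + h n = D * / 2 ^ n) by (unfold l, h, D; field; specialize (P2 n); lra).
    specialize (Hok n).
    assert (En : E n <= eta * (l n + h n) ^ 2).
    { apply HL; auto.
      - rewrite El. apply (Rmult_lt_compat_l D) in Hn; [|lra].
        replace (D * (delta / D)) with delta in Hn by (field; lra). exact Hn.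
      - eapply continuous_on_rect_sub; [ | | | | exact CP]; lra.
      - eapply continuous_on_rect_sub; [ | | | | exact CQ]; lra. }
    specialize (HE n). eapply Rle_trans. exact HE.
    apply Rle_trans with (4 ^ n * (eta * (l n + h n) ^ 2)).
    { apply Rmult_le_compat_l; auto. left; apply pow_lt; lra. }
    right. rewrite El. replace (4 ^ n) with (2 ^ n * 2 ^ n).
    - specialize (P2 n). field. lra.
    - rewrite <- Rpow_mult_distr. now replace (2 * 2) with 4 by lra. }
  assert (E0 : E O = Rabs (circulation P Q a b c d)).
  { unfold E, A, C0, l, h. simpl. do 2 f_equal; field. }
  rewrite E0 in small.
  destruct (Req_dec (circulation P Q a b c d) 0) as [|N]; auto. exfalso.
  apply Rabs_pos_lt in N. set (X := Rabs (circulation P Q a b c d)) in *.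
  (* This [eta] yields [X <= X / 2], impossible for [X > 0]. *)
  specialize (small (X / 2 / D ^ 2)).
  assert (0 < D ^ 2) by (apply pow_lt; auto).
  assert (X <= X / 2); [|lra].
  replace (X / 2) with (X / 2 / D ^ 2 * D ^ 2) by (field; lra). apply small.
  apply Rdiv_lt_0_compat; lra.
Qed.

(** * Steklov averages *)

Lemma differentiable_pt_lim_linear a b x y :
  differentiable_pt_lim (fun u v => a * u + b * v) x y a b.
Proof.
  intros eps. exists (mkposreal 1 Rlt_0_1). intros u v _ _.
  replace (_ - _ - _) with 0 by ring. rewrite Rabs_R0.
  apply Rmult_le_pos. left; apply cond_pos. eapply Rle_trans; [apply Rabs_pos | apply Rmax_l].
Qed.

Lemma differentiable_pt_lim_eq f x y lx ly lx' ly' :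
  differentiable_pt_lim f x y lx ly -> lx = lx' -> ly = ly' ->
  differentiable_pt_lim f x y lx' ly'.
Proof. now intros ? <- <-. Qed.

Definition backward (h : R) (U : R -> R -> R) (s t : R) : R := (U s t - U (s - h) t) / h.

(** The window lies to the left of [s], so a value at [s < 0] depends only on the half-plane;
    averaging in [s] alone preserves the period in [t]. *)
Definition steklov (h : R) (U : R -> R -> R) (s t : R) : R :=
  RInt (fun x => U x t) (s - h) s / h.

Lemma differentiable_pt_lim_shift U h s t a b :
  differentiable_pt_lim U (s - h) t a b ->
  differentiable_pt_lim (fun x y => U (x - h) y) s t a b.
Proof.
  intros H.
  eapply differentiable_pt_lim_eq.
  - apply (differentiable_pt_lim_comp U (fun x _ => x - h) (fun _ y => y) s t a b 1 0 0 1 H).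
    + apply differentiable_pt_lim_proj1_0. apply is_derive_Reals. auto_derive; auto.
    + apply (differentiable_pt_lim_ext (fun x y => 0 * x + 1 * y)).
      apply locally_2d_forall; intros; ring. apply differentiable_pt_lim_linear.
  - ring.
  - ring.
Qed.

Lemma differentiable_pt_lim_backward U h s t a b a' b' :
  h <> 0 ->
  differentiable_pt_lim U s t a b -> differentiable_pt_lim U (s - h) t a' b' ->
  differentiable_pt_lim (backward h U) s t ((a - a') / h) ((b - b') / h).
Proof.
  intros Hh H1 H2.
  eapply differentiable_pt_lim_eq.
  - apply (differentiable_pt_lim_ext
      (fun x y => / h * U x y + (- / h) * U (x - h) y)).
    { apply locally_2d_forall. intros. unfold backward. field. exact Hh. }
    apply (differentiable_pt_lim_comp (fun u v => / h * u + (- / h) * v) U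
      (fun x y => U (x - h) y) s t (/ h) (- / h) a b a' b').
    apply differentiable_pt_lim_linear. exact H1.
    apply differentiable_pt_lim_shift. exact H2.
  - field; exact Hh.
  - field; exact Hh.
Qed.

Lemma continuity_2d_pt_shift U h s t :
  continuity_2d_pt U (s - h) t -> continuity_2d_pt (fun x y => U (x - h) y) s t.
Proof.
  intros H eps. destruct (H eps) as [d Hd]. exists d. intros u v Hu Hv.
  apply Hd. 2: exact Hv. now replace (u - h - (s - h)) with (u - s) by ring.
Qed.

Lemma continuity_2d_pt_backward U h s t :
  continuity_2d_pt U s t -> continuity_2d_pt U (s - h) t ->
  continuity_2d_pt (backward h U) s t.
Proof.
  intros H1 H2. unfold backward, Rdiv. apply continuity_2d_pt_mult.
  2: apply continuity_2d_pt_const.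
  apply continuity_2d_pt_minus. exact H1. now apply continuity_2d_pt_shift.
Qed.

(** Closedness of [P ds + Q dt] on the left half-plane: the shared [k] is the equation P_t = Q_s.
    The derivatives are only required to exist at each point, which is what complex
    differentiability provides. *)
Definition closed_form (P Q : R -> R -> R) : Prop :=
  forall s t, s < 0 -> exists px k qy,
    differentiable_pt_lim P s t px k /\ differentiable_pt_lim Q s t k qy.

Lemma closed_form_continuity P Q s t :
  closed_form P Q -> s < 0 -> continuity_2d_pt P s t /\ continuity_2d_pt Q s t.
Proof.
  intros H Hs. destruct (H s t Hs) as (px & k & qy & H1 & H2).
  split; eapply differentiable_pt_lim_continuity; eassumption.
Qed.

Lemma closed_form_circulation P Q a b c d :
  closed_form P Q -> a < b -> b < 0 -> c < d -> circulation P Q a b c d = 0.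
Proof.
  intros H Hab Hb Hcd.
  apply (goursat_rectangle P Q (fun s t => Derive (fun x => P x t) s)
    (fun s t => Derive (fun x => Q x t) s) (fun s t => Derive (fun y => Q s y) t)); auto.
  intros s t Hs Ht. destruct (H s t ltac:(lra)) as (px & k & qy & H1 & H2).
  destruct (differentiable_pt_lim_unique _ _ _ _ _ H1) as [-> _].
  destruct (differentiable_pt_lim_unique _ _ _ _ _ H2) as [-> ->]. auto.
Qed.

Lemma ex_RInt_half_plane_1 P a b t :
  (forall s, s < 0 -> continuity_2d_pt P s t) -> a < 0 -> b < 0 ->
  ex_RInt (fun s => P s t) a b.
Proof.
  intros H Ha Hb. apply (@ex_RInt_continuous R_CompleteNormedModule).
  intros z Hz. apply (continuity_2d_pt_continuous_1 P). apply H.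
  eapply Rle_lt_trans. apply Hz. now apply Rmax_lub_lt.
Qed.

Lemma ex_RInt_half_plane_2 Q s c d :
  (forall t, continuity_2d_pt Q s t) -> ex_RInt (fun t => Q s t) c d.
Proof.
  intros H. apply (@ex_RInt_continuous R_CompleteNormedModule).
  intros z Hz. apply (continuity_2d_pt_continuous_2 Q). apply H.
Qed.

Lemma is_derive_RInt_R (f : R -> R) (a b : R) :
  (forall x, continuous f x) -> is_derive (fun x => RInt f a x) b (f b).
Proof.
  intros H. apply (is_derive_RInt f _ a).
  - apply filter_forall. intros x. apply (RInt_correct (V := R_CompleteNormedModule)).
    apply (@ex_RInt_continuous R_CompleteNormedModule). auto.
  - apply H.
Qed.

(** Goursat on [a, b] x [c, y] expresses the integral along height [y] as the one along height [c]
    plus the integral of [Q b - Q a] from [c] to [y]; the fundamental theorem then differentiates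
    it. This replaces differentiation under the integral sign, which would call for a continuous
    P_t. *)
Lemma closed_form_derive_RInt P Q a b t :
  closed_form P Q -> a < b -> b < 0 ->
  is_derive (fun y => RInt (fun s => P s y) a b) t (Q b t - Q a t).
Proof.
  intros H Hab Hb.
  assert (CP : forall s y, s < 0 -> continuity_2d_pt P s y)
    by (intros; now apply (closed_form_continuity P Q)).
  assert (CQ : forall s y, s < 0 -> continuity_2d_pt Q s y)
    by (intros; now apply (closed_form_continuity P Q)).
  set (g := fun y => Q b y - Q a y).
  assert (Cg : forall y, continuous g y).
  { intros y. apply (continuous_minus (V := R_NormedModule));
    apply (continuity_2d_pt_continuous_2 Q), CQ; lra. }
  assert (Eq : forall c y, c <= y ->
     RInt (fun s => P s y) a b = RInt (fun s => P s c) a b + RInt g c y).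
  { intros c y [Hy | <-].
    - pose proof (closed_form_circulation P Q a b c y H Hab Hb Hy) as E.
      rewrite circulation_expand in E;
      [ | apply ex_RInt_half_plane_1; intros; auto; lra
        | apply ex_RInt_half_plane_1; intros; auto; lra
        | apply ex_RInt_half_plane_2; intros; apply CQ; lra
        | apply ex_RInt_half_plane_2; intros; apply CQ; lra].
      unfold g. rewrite (RInt_minus_R (fun t => Q b t) (fun t => Q a t));
      [ | apply ex_RInt_half_plane_2; intros; apply CQ; lra
        | apply ex_RInt_half_plane_2; intros; apply CQ; lra].
      lra.
    - rewrite RInt_point. unfold zero; simpl. lra. }
  (* [Eq] covers only [c <= y]; the base [t - 1] makes it valid on both sides of [t]. *)
  apply (is_derive_ext_loc (fun y => RInt (fun s => P s (t - 1)) a b + RInt g (t - 1) y)).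
  - exists (mkposreal 1 Rlt_0_1). intros y Hy. symmetry. apply Eq.
    change (Rabs (y - t) < 1) in Hy. apply Rabs_lt_between in Hy. lra.
  - replace (Q b t - Q a t) with (0 + g t) by (unfold g; ring).
    apply (is_derive_plus (V := R_NormedModule)).
    apply (is_derive_const (V := R_NormedModule)). now apply is_derive_RInt_R.
Qed.

Lemma is_derive_RInt_window (f : R -> R) h s :
  0 < h -> s < 0 -> (forall x, x < 0 -> continuous f x) ->
  is_derive (fun x => RInt f (x - h) x) s (f s - f (s - h)).
Proof.
  intros Hh Hs Hc.
  assert (X : forall a b, a < 0 -> b < 0 -> ex_RInt f a b).
  { intros a b Ha Hb. apply (@ex_RInt_continuous R_CompleteNormedModule).
    intros z Hz. apply Hc. eapply Rle_lt_trans. apply Hz. now apply Rmax_lub_lt. }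
  assert (D : forall x, x < 0 -> is_derive (fun y => RInt f (s - h) y) x (f x)).
  { intros x Hx. apply (is_derive_RInt f _ (s - h)); auto.
    assert (Hx' : 0 < - x) by lra.
    exists (mkposreal _ Hx'). intros y Hy.
    change (Rabs (y - x) < - x) in Hy. apply Rabs_lt_between in Hy.
    apply (RInt_correct (V := R_CompleteNormedModule)). apply X; lra. }
  apply (is_derive_ext_loc (fun x => RInt f (s - h) x - RInt f (s - h) (x - h))).
  - assert (Hs' : 0 < - s) by lra. exists (mkposreal _ Hs'). intros y Hy.
    change (Rabs (y - s) < - s) in Hy. apply Rabs_lt_between in Hy.
    simpl. rewrite (RInt_Chasles_R f (s - h) (y - h) y) by (apply X; lra). lra.
  - apply (is_derive_minus (V := R_NormedModule)). now apply D.
    replace (f (s - h)) with (1 * f (s - h)) by ring.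
    apply (is_derive_comp (fun y => RInt f (s - h) y) (fun x => x - h)).
    apply D; lra. auto_derive; auto.
Qed.

(** The [s]-partial comes from the fundamental theorem, the [t]-partial from closedness, which
    trades P_t for differences of [Q]. Since the [s]-partial is jointly continuous, the two partials
    combine into differentiability. *)
Lemma differentiable_pt_lim_steklov P Q h s t :
  closed_form P Q -> 0 < h -> s < 0 ->
  differentiable_pt_lim (steklov h P) s t (backward h P s t) (backward h Q s t).
Proof.
  intros H Hh Hs.
  assert (CP : forall s y, s < 0 -> continuity_2d_pt P s y)
    by (intros; now apply (closed_form_continuity P Q)).
  apply filterdiff_differentiable_pt_lim.
  apply (is_derive_filterdiff (steklov h P) s t (backward h P) (backward h Q s t)).
  - assert (Hs' : 0 < - s) by lra. exists (mkposreal _ Hs').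
    intros [x y] [Hx _]. simpl in *.
    change (Rabs (x - s) < - s) in Hx. apply Rabs_lt_between in Hx.
    apply (is_derive_ext (fun z => / h * RInt (fun x => P x y) (z - h) z)).
    { intros z. unfold steklov, Rdiv. simpl. ring. }
    replace (backward h P x y) with (/ h * (P x y - P (x - h) y))
      by (unfold backward; field; lra).
    apply is_derive_scal.
    apply (is_derive_RInt_window (fun x => P x y)); try lra.
    intros z Hz. apply (continuity_2d_pt_continuous_1 P). auto.
  - apply (is_derive_ext (fun y => / h * RInt (fun x => P x y) (s - h) s)).
    { intros z. unfold steklov, Rdiv. simpl. ring. }
    replace (backward h Q s t) with (/ h * (Q s t - Q (s - h) t))
      by (unfold backward; field; lra).
    apply is_derive_scal. apply (closed_form_derive_RInt P Q); auto; lra.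
  - apply (proj1 (continuity_2d_pt_filterlim (backward h P) s t)).
    apply continuity_2d_pt_backward; apply CP; lra.
Qed.

(* [U + iV] is holomorphic on the left half-plane with derivative [U' + iV']. *)
Definition cauchy_riemann (U V U' V' : R -> R -> R) : Prop :=
  forall s t, s < 0 ->
    differentiable_pt_lim U s t (U' s t) (- V' s t) /\
    differentiable_pt_lim V s t (V' s t) (U' s t).

(** These are the imaginary and real parts of (U + iV)(ds + i dt), namely [V ds + U dt] and
    [U ds - V dt]. *)
Lemma cauchy_riemann_closed U V U' V' :
  cauchy_riemann U V U' V' -> closed_form V U /\ closed_form U (fun s t => - V s t).
Proof.
  intros H. split; intros s t Hs; destruct (H s t Hs) as [H1 H2].
  - now exists (V' s t), (U' s t), (- V' s t).
  - exists (U' s t), (- V' s t), (- U' s t). split. exact H1.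
    eapply differentiable_pt_lim_eq.
    + apply (differentiable_pt_lim_ext (fun x y => (-1) * V x y + 0 * V x y)).
      apply locally_2d_forall; intros; ring.
      apply (differentiable_pt_lim_comp (fun u v => (-1) * u + 0 * v) V V s t).
      apply differentiable_pt_lim_linear. exact H2. exact H2.
    + ring.
    + ring.
Qed.

Lemma cauchy_riemann_continuity U V U' V' s t :
  cauchy_riemann U V U' V' -> s < 0 -> continuity_2d_pt U s t /\ continuity_2d_pt V s t.
Proof.
  intros H Hs. destruct (cauchy_riemann_closed _ _ _ _ H) as [H1 _].
  destruct (closed_form_continuity _ _ s t H1 Hs); auto.
Qed.

Lemma cauchy_riemann_backward U V U' V' h :
  0 < h -> cauchy_riemann U V U' V' ->
  cauchy_riemann (backward h U) (backward h V) (backward h U') (backward h V').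
Proof.
  intros Hh H s t Hs.
  destruct (H s t Hs) as [A1 A2]. destruct (H (s - h) t ltac:(lra)) as [B1 B2].
  split.
  - eapply differentiable_pt_lim_eq.
    + apply (differentiable_pt_lim_backward U h s t _ _ _ _ ltac:(lra) A1 B1).
    + reflexivity.
    + unfold backward. field. lra.
  - exact (differentiable_pt_lim_backward V h s t _ _ _ _ ltac:(lra) A2 B2).
Qed.

(** Averaging gains a derivative: the derivative of the average is a difference quotient of
    [U + iV], so it inherits the regularity of [U] and [V] rather than that of [U'] and [V']. *)
Lemma cauchy_riemann_steklov U V U' V' h :
  0 < h -> cauchy_riemann U V U' V' ->
  cauchy_riemann (steklov h U) (steklov h V) (backward h U) (backward h V).
Proof.
  intros Hh H s t Hs. destruct (cauchy_riemann_closed _ _ _ _ H) as [C1 C2]. split.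
  - eapply differentiable_pt_lim_eq.
    + apply (differentiable_pt_lim_steklov _ _ h s t C2 Hh Hs).
    + reflexivity.
    + unfold backward. field. lra.
  - apply (differentiable_pt_lim_steklov _ _ h s t C1 Hh Hs).
Qed.

(** * Circle means of functions with nonnegative Laplacian *)

(* [L] is the Laplacian of [E]; of the periodicity in [t] only
   [Et s 0 = Et s (2 * PI)] is needed. *)
Definition periodic_C2 (E L : R -> R -> R) : Prop :=
  exists Es Ess Et Ett : R -> R -> R,
    (forall s t, s < 0 ->
       (is_derive (fun x => E x t) s (Es s t) /\ is_derive (fun x => Es x t) s (Ess s t)) /\
       (is_derive (fun y => E s y) t (Et s t) /\ is_derive (fun y => Et s y) t (Ett s t)) /\
       (continuity_2d_pt E s t /\ continuity_2d_pt Es s t) /\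
       (continuity_2d_pt Ess s t /\ continuity_2d_pt Ett s t) /\
       L s t = Ess s t + Ett s t) /\
    (forall s, s < 0 -> Et s 0 = Et s (2 * PI)).

Lemma is_derive_lincomb (f g : R -> R) x f' g' c d :
  is_derive f x f' -> is_derive g x g' ->
  is_derive (fun y => c * f y + d * g y) x (c * f' + d * g').
Proof.
  intros H1 H2. apply (is_derive_plus (V := R_NormedModule)); now apply is_derive_scal.
Qed.

Lemma continuity_2d_pt_lincomb f g x y c d :
  continuity_2d_pt f x y -> continuity_2d_pt g x y ->
  continuity_2d_pt (fun u v => c * f u v + d * g u v) x y.
Proof.
  intros. apply continuity_2d_pt_plus; apply continuity_2d_pt_mult; auto;
  apply continuity_2d_pt_const.
Qed.

Lemma periodic_C2_lincomb E L E' L' c d :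
  periodic_C2 E L -> periodic_C2 E' L' ->
  periodic_C2 (fun s t => c * E s t + d * E' s t) (fun s t => c * L s t + d * L' s t).
Proof.
  intros (Es & Ess & Et & Ett & H & P) (Es' & Ess' & Et' & Ett' & H' & P').
  exists (fun s t => c * Es s t + d * Es' s t), (fun s t => c * Ess s t + d * Ess' s t),
    (fun s t => c * Et s t + d * Et' s t), (fun s t => c * Ett s t + d * Ett' s t).
  split.
  - intros s t Hs.
    destruct (H s t Hs) as ((A1 & A2) & (A3 & A4) & (A5 & A6) & (A7 & A8) & A9).
    destruct (H' s t Hs) as ((B1 & B2) & (B3 & B4) & (B5 & B6) & (B7 & B8) & B9).
    refine (conj (conj _ _) (conj (conj _ _) (conj (conj _ _) (conj (conj _ _) _)))).
    + exact (is_derive_lincomb _ _ _ _ _ c d A1 B1).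
    + exact (is_derive_lincomb _ _ _ _ _ c d A2 B2).
    + exact (is_derive_lincomb _ _ _ _ _ c d A3 B3).
    + exact (is_derive_lincomb _ _ _ _ _ c d A4 B4).
    + now apply continuity_2d_pt_lincomb.
    + now apply continuity_2d_pt_lincomb.
    + now apply continuity_2d_pt_lincomb.
    + now apply continuity_2d_pt_lincomb.
    + rewrite A9, B9. ring.
  - intros s Hs. rewrite (P s Hs), (P' s Hs). reflexivity.
Qed.

Definition circle_int (E : R -> R -> R) (s : R) : R := RInt (fun t => E s t) 0 (2 * PI).

Lemma is_derive_circle_int E Es s :
  (forall x t, x < 0 -> is_derive (fun y => E y t) x (Es x t)) ->
  (forall x t, x < 0 -> continuity_2d_pt E x t /\ continuity_2d_pt Es x t) ->
  s < 0 -> is_derive (circle_int E) s (circle_int Es s).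
Proof.
  intros HD HC Hs. unfold circle_int.
  assert (Hs' : 0 < - s) by lra.
  assert (N : forall y, ball s (mkposreal _ Hs') y -> y < 0).
  { intros y Hy. change (Rabs (y - s) < - s) in Hy. apply Rabs_lt_between in Hy. lra. }
  replace (RInt (fun t => Es s t) 0 (2 * PI))
    with (RInt (fun t => Derive (fun u => E u t) s) 0 (2 * PI)).
  2:{ apply RInt_ext. intros t _. apply is_derive_unique. now apply HD. }
  apply is_derive_RInt_param.
  - exists (mkposreal _ Hs'). intros y Hy t _. exists (Es y t). apply HD. now apply N.
  - intros t _. apply (continuity_2d_pt_ext_loc Es).
    + exists (mkposreal _ Hs'). intros u v Hu _. symmetry. apply is_derive_unique.
      apply HD. apply N. exact Hu.
    + now apply HC.
  - exists (mkposreal _ Hs'). intros y Hy. apply ex_RInt_half_plane_2.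
    intros t. apply HC. now apply N.
Qed.

(* The [t]-part of the Laplacian integrates to 0 over a period, so the integral
   is a convex function of [s]. *)
Lemma circle_int_convex E L :
  periodic_C2 E L -> (forall s t, s < 0 -> 0 <= L s t) ->
  exists M' : R -> R, (forall s, s < 0 -> is_derive (circle_int E) s (M' s)) /\
    (forall s1 s2, s1 <= s2 -> s2 < 0 -> M' s1 <= M' s2).
Proof.
  intros (Es & Ess & Et & Ett & H & P) HL.
  exists (circle_int Es). split.
  - intros s Hs. apply is_derive_circle_int; auto; intros x t Hx; apply (H x t Hx).
  - assert (D2 : forall s, s < 0 -> is_derive (circle_int Es) s (circle_int Ess s)).
    { intros s Hs. apply is_derive_circle_int; auto; intros x t Hx.
      apply (H x t Hx). split; apply (H x t Hx). }
    assert (Pos : forall s, s < 0 -> 0 <= circle_int Ess s).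
    { intros s Hs.
      assert (X1 : ex_RInt (fun t => Ess s t) 0 (2 * PI)).
      { apply ex_RInt_half_plane_2. intros t. apply (H s t Hs). }
      assert (X2 : is_RInt (fun t => Ett s t) 0 (2 * PI) 0).
      { replace 0 with (minus (Et s (2 * PI)) (Et s 0)) at 2.
        2:{ rewrite (P s Hs). unfold minus, plus, opp; simpl. ring. }
        apply (is_RInt_derive (V := R_CompleteNormedModule)).
        intros t _. apply (H s t Hs).
        intros t _. apply (continuity_2d_pt_continuous_2 Ett). apply (H s t Hs). }
      assert (X3 : circle_int Ess s = RInt (fun t => Ess s t + Ett s t) 0 (2 * PI)).
      { symmetry. apply is_RInt_unique.
        replace (circle_int Ess s) with (circle_int Ess s + 0) by ring.
        apply (is_RInt_plus (V := R_NormedModule)); auto.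
        apply (RInt_correct (V := R_CompleteNormedModule)). exact X1. }
      rewrite X3. apply RInt_ge_0. pose proof PI_RGT_0; lra.
      - apply (ex_RInt_plus (V := R_NormedModule)). exact X1. now exists 0.
      - intros t _. destruct (H s t Hs) as (_ & _ & _ & _ & <-). now apply HL. }
    intros s1 s2 H12 H2.
    destruct (MVT_gen (circle_int Es) s1 s2 (circle_int Ess)) as [c [Hc E0]].
    + intros x Hx. apply D2. rewrite Rmax_right in Hx by lra. lra.
    + intros x Hx. rewrite Rmax_right in Hx by lra.
      apply continuity_pt_filterlim.
      apply (ex_derive_continuous (V := R_NormedModule)).
      exists (circle_int Ess x). apply D2; lra.
    + rewrite Rmax_right in Hc by lra. specialize (Pos c ltac:(lra)). nra.
Qed.

(** A negative slope at some [s] would persist to the left of it by convexity, and [M] would grow at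
    least linearly towards minus infinity, against the bound [K]. *)
Lemma convex_bounded_nondecreasing (M M' : R -> R) K S :
  (forall s, s < 0 -> is_derive M s (M' s)) ->
  (forall s1 s2, s1 <= s2 -> s2 < 0 -> M' s1 <= M' s2) ->
  (forall s, s < S -> M s <= K) ->
  forall s1 s2, s1 <= s2 -> s2 < 0 -> M s1 <= M s2.
Proof.
  intros HD Hc HK.
  assert (MV : forall s1 s2, s1 <= s2 -> s2 < 0 ->
     exists c, s1 <= c <= s2 /\ M s2 - M s1 = M' c * (s2 - s1)).
  { intros s1 s2 H12 H2. destruct (MVT_gen M s1 s2 M') as [c [Hc' E0]].
    + intros x Hx. rewrite Rmax_right in Hx by lra. apply HD; lra.
    + intros x Hx. rewrite Rmax_right in Hx by lra.
      apply continuity_pt_filterlim.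
      apply (ex_derive_continuous (V := R_NormedModule)).
      exists (M' x). apply HD; lra.
    + rewrite Rmin_left, Rmax_right in Hc' by lra. now exists c. }
  assert (Pos : forall s, s < 0 -> 0 <= M' s).
  { intros s Hs. destruct (Rle_lt_dec 0 (M' s)) as [|Neg]; auto. exfalso.
    (* Left of [S], so that [K] applies, and so far from [s] that a slope of at most [M' s] forces
       [M x] to be at least [M s + Rabs (K - M s) + 1], which exceeds [K]. *)
    set (x := Rmin (S - 1) (s - (Rabs (K - M s) + 1) / - M' s)).
    pose proof (Rmin_l (S - 1) (s - (Rabs (K - M s) + 1) / - M' s)).
    pose proof (Rmin_r (S - 1) (s - (Rabs (K - M s) + 1) / - M' s)). fold x in H, H0.
    pose proof (Rabs_pos (K - M s)).
    assert (Q : 0 < (Rabs (K - M s) + 1) / - M' s) by (apply Rdiv_lt_0_compat; lra).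
    destruct (MV x s) as (c & Hcx & E0); try lra.
    specialize (Hc c s ltac:(lra) Hs). specialize (HK x ltac:(lra)).
    assert (Rabs (K - M s) + 1 <= - M' s * (s - x)).
    { apply Rle_trans with (- M' s * ((Rabs (K - M s) + 1) / - M' s)).
      right; field; lra. apply Rmult_le_compat_l; lra. }
    pose proof (Rle_abs (K - M s)). nra. }
  intros s1 s2 H12 H2. destruct (MV s1 s2 H12 H2) as (c & Hcx & E0).
  specialize (Pos c ltac:(lra)). nra.
Qed.

Lemma circle_int_nondecreasing E L K S :
  periodic_C2 E L -> (forall s t, s < 0 -> 0 <= L s t) ->
  (forall s t, s < S -> E s t <= K) ->
  forall s1 s2, s1 <= s2 -> s2 < 0 -> circle_int E s1 <= circle_int E s2.
Proof.
  intros HE HL HK. destruct (circle_int_convex E L HE HL) as (M' & D & C).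
  apply (convex_bounded_nondecreasing _ M' (2 * PI * K) (Rmin S 0) D C).
  intros s Hs. pose proof (Rmin_l S 0). pose proof (Rmin_r S 0).
  unfold circle_int.
  replace (2 * PI * K) with (RInt (fun _ => K) 0 (2 * PI)).
  2:{ rewrite RInt_const. unfold scal; simpl; unfold mult; simpl. ring. }
  apply RInt_le. pose proof PI_RGT_0; lra.
  - apply ex_RInt_half_plane_2. intros t.
    destruct HE as (Es & Ess & Et & Ett & HE & _). apply (HE s t). lra.
  - apply ex_RInt_const.
  - intros t _. apply HK. lra.
Qed.

(** * Powers of regularised quadratic forms and their Laplacians *)

Lemma is_derive_Rpower (x k : R) :
  0 < x -> is_derive (fun y => Rpower y k) x (k * Rpower x (k - 1)).
Proof. intros. apply is_derive_Reals. now apply derivable_pt_lim_power. Qed.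

Definition quad (a b e x y : R) : R := a * x ^ 2 + b * y ^ 2 + e.

Lemma quad_pos a b e x y : 0 <= a -> 0 <= b -> 0 < e -> 0 < quad a b e x y.
Proof. intros. unfold quad. nra. Qed.

Lemma is_derive_quad a b e (A B : R -> R) x A1 B1 :
  is_derive A x A1 -> is_derive B x B1 ->
  is_derive (fun z => quad a b e (A z) (B z)) x (2 * a * A x * A1 + 2 * b * B x * B1).
Proof.
  intros HA HB. unfold quad. auto_derive.
  - repeat split. now exists A1. now exists B1.
  - replace (Derive (fun x => A x) x) with A1 by (symmetry; now apply is_derive_unique).
    replace (Derive (fun x => B x) x) with B1 by (symmetry; now apply is_derive_unique).
    ring.
Qed.

Lemma is_derive_quad_power a b e k (A B : R -> R) x A1 B1 :
  0 <= a -> 0 <= b -> 0 < e -> is_derive A x A1 -> is_derive B x B1 ->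
  is_derive (fun z => Rpower (quad a b e (A z) (B z)) k) x
    (k * Rpower (quad a b e (A x) (B x)) (k - 1) * (2 * a * A x * A1 + 2 * b * B x * B1)).
Proof.
  intros Ha Hb He HA HB. rewrite Rmult_comm.
  apply (is_derive_comp (fun y => Rpower y k) (fun z => quad a b e (A z) (B z))).
  - apply is_derive_Rpower. now apply quad_pos.
  - now apply is_derive_quad.
Qed.

Lemma is_derive_quad_power_2 a b e k (A B A1 B1 : R -> R) x A2 B2 :
  0 <= a -> 0 <= b -> 0 < e ->
  is_derive A x (A1 x) -> is_derive B x (B1 x) -> is_derive A1 x A2 -> is_derive B1 x B2 ->
  is_derive (fun z => k * Rpower (quad a b e (A z) (B z)) (k - 1) *
                      (2 * a * A z * A1 z + 2 * b * B z * B1 z)) x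
    (k * (k - 1) * Rpower (quad a b e (A x) (B x)) (k - 2) *
        (2 * a * A x * A1 x + 2 * b * B x * B1 x) ^ 2 +
     k * Rpower (quad a b e (A x) (B x)) (k - 1) *
        (2 * a * (A1 x ^ 2 + A x * A2) + 2 * b * (B1 x ^ 2 + B x * B2))).
Proof.
  intros Ha Hb He HA HB HA1 HB1.
  pose proof (is_derive_quad_power a b e (k - 1) A B x _ _ Ha Hb He HA HB) as D1.
  assert (D2 : is_derive (fun z => 2 * a * A z * A1 z + 2 * b * B z * B1 z) x
    (2 * a * (A1 x ^ 2 + A x * A2) + 2 * b * (B1 x ^ 2 + B x * B2))).
  { auto_derive.
    - repeat split; eexists; eassumption.
    - replace (Derive (fun x => A x) x) with (A1 x) by (symmetry; now apply is_derive_unique).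
      replace (Derive (fun x => B x) x) with (B1 x) by (symmetry; now apply is_derive_unique).
      replace (Derive (fun x => A1 x) x) with A2 by (symmetry; now apply is_derive_unique).
      replace (Derive (fun x => B1 x) x) with B2 by (symmetry; now apply is_derive_unique).
      ring. }
  replace (k - 1 - 1) with (k - 2) in D1 by ring.
  set (F := fun z => Rpower (quad a b e (A z) (B z)) (k - 1)) in *.
  set (G := fun z => 2 * a * A z * A1 z + 2 * b * B z * B1 z) in *.
  apply (is_derive_ext (fun z => k * (F z * G z))).
  { intros z. unfold F, G. simpl. ring. }
  match goal with |- is_derive _ _ ?v =>
    replace v with (k * ((k - 1) * Rpower (quad a b e (A x) (B x)) (k - 2) *
       (2 * a * A x * A1 x + 2 * b * B x * B1 x) * G x + F x *
    (2 * a * (A1 x ^ 2 + A x * A2) + 2 * b * (B1 x ^ 2 + B x * B2))))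
    by (unfold F, G; ring) end.
  apply is_derive_scal.
  apply (is_derive_mult F G x _ _ D1 D2). intros; apply Rmult_comm.
Qed.

Lemma differentiable_pt_lim_is_derive f x y lx ly :
  differentiable_pt_lim f x y lx ly ->
  is_derive (fun s => f s y) x lx /\ is_derive (fun t => f x t) y ly.
Proof.
  intros H. split; apply is_derive_Reals.
  - replace lx with (lx * 1 + ly * 0) by ring.
    apply (derivable_pt_lim_comp_2d f (fun s => s) (fun _ => y) x); auto.
    apply derivable_pt_lim_id. apply derivable_pt_lim_const.
  - replace ly with (lx * 0 + ly * 1) by ring.
    apply (derivable_pt_lim_comp_2d f (fun _ => x) (fun s => s) y); auto.
    apply derivable_pt_lim_const. apply derivable_pt_lim_id.
Qed.

Lemma cauchy_riemann_is_derive U V U' V' s t :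
  cauchy_riemann U V U' V' -> s < 0 ->
  (is_derive (fun x => U x t) s (U' s t) /\ is_derive (fun y => U s y) t (- V' s t)) /\
  (is_derive (fun x => V x t) s (V' s t) /\ is_derive (fun y => V s y) t (U' s t)).
Proof.
  intros H Hs. destruct (H s t Hs). split; now apply differentiable_pt_lim_is_derive.
Qed.

Definition quad_power (a b e k : R) (A B : R -> R -> R) (s t : R) : R :=
  Rpower (quad a b e (A s t) (B s t)) k.

(* The Laplacian of [quad_power] is [|g'|^2] times this density. *)
Definition lap_density (a b e k x y : R) : R :=
  4 * k * (k - 1) * Rpower (quad a b e x y) (k - 2) * ((a * x) ^ 2 + (b * y) ^ 2) +
  2 * k * (a + b) * Rpower (quad a b e x y) (k - 1).

Lemma continuity_2d_pt_Rpower f x y k :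
  continuity_2d_pt f x y -> 0 < f x y ->
  continuity_2d_pt (fun u v => Rpower (f u v) k) x y.
Proof.
  intros H Hp. apply (continuity_1d_2d_pt_comp (fun z => Rpower z k)); auto.
  apply continuity_pt_filterlim.
  apply (ex_derive_continuous (V := R_NormedModule) (fun z => Rpower z k) (f x y)).
  eexists. now apply is_derive_Rpower.
Qed.

Lemma continuity_2d_pt_sqr f x y :
  continuity_2d_pt f x y -> continuity_2d_pt (fun u v => f u v ^ 2) x y.
Proof.
  intros H. apply (continuity_2d_pt_ext (fun u v => f u v * f u v)).
  intros; ring. now apply continuity_2d_pt_mult.
Qed.

Ltac continuity_2d :=
  repeat first [ assumption | apply continuity_2d_pt_const
    | apply continuity_2d_pt_plus | apply continuity_2d_pt_sqr | apply continuity_2d_pt_mult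
    | apply continuity_2d_pt_opp ].

Lemma continuity_2d_pt_quad a b e A B x y :
  continuity_2d_pt A x y -> continuity_2d_pt B x y ->
  continuity_2d_pt (fun u v => quad a b e (A u v) (B u v)) x y.
Proof. intros. unfold quad. continuity_2d. Qed.

(** By Cauchy-Riemann, a [t]-derivative is [i] times an [s]-derivative. Hence the [t]-derivatives
    are the same expressions [D1] and [D2] with [(A1, B1)] replaced by [(-B1, A1)] and [(A2, B2)] by
    [(-A2, -B2)]. In the sum the second derivatives cancel, and the two squares add up to
    [4 * (A1^2 + B1^2) * ((a A)^2 + (b B)^2)]. *)
Lemma quad_power_C2 (A B A1 B1 A2 B2 : R -> R -> R) a b e k :
  cauchy_riemann A B A1 B1 -> cauchy_riemann A1 B1 A2 B2 ->
  (forall s t, s < 0 -> continuity_2d_pt A2 s t /\ continuity_2d_pt B2 s t) ->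
  (forall s, s < 0 -> A s 0 = A s (2 * PI) /\ B s 0 = B s (2 * PI) /\
     A1 s 0 = A1 s (2 * PI) /\ B1 s 0 = B1 s (2 * PI)) ->
  0 <= a -> 0 <= b -> 0 < e ->
  periodic_C2 (quad_power a b e k A B)
    (fun s t => (A1 s t ^ 2 + B1 s t ^ 2) * lap_density a b e k (A s t) (B s t)).
Proof.
  intros H1 H2 HC HP Ha Hb He.
  set (y := fun s t => quad a b e (A s t) (B s t)).
  set (D1 := fun A1 B1 s t => k * Rpower (y s t) (k - 1) *
     (2 * a * A s t * A1 s t + 2 * b * B s t * B1 s t)).
  set (D2 := fun A1 B1 A2 B2 s t =>
     k * (k - 1) * Rpower (y s t) (k - 2) *
        (2 * a * A s t * A1 s t + 2 * b * B s t * B1 s t) ^ 2 +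
     k * Rpower (y s t) (k - 1) *
        (2 * a * (A1 s t ^ 2 + A s t * A2 s t) + 2 * b * (B1 s t ^ 2 + B s t * B2 s t))).
  exists (D1 A1 B1), (D2 A1 B1 A2 B2), (D1 (fun s t => - B1 s t) A1),
    (D2 (fun s t => - B1 s t) A1 (fun s t => - A2 s t) (fun s t => - B2 s t)).
  split.
  - intros s t Hs.
    destruct (cauchy_riemann_is_derive _ _ _ _ s t H1 Hs) as ((As & At) & (Bs & Bt)).
    destruct (cauchy_riemann_is_derive _ _ _ _ s t H2 Hs) as ((A1s & A1t) & (B1s & B1t)).
    destruct (cauchy_riemann_continuity _ _ _ _ s t H1 Hs) as [CA CB].
    destruct (cauchy_riemann_continuity _ _ _ _ s t H2 Hs) as [CA1 CB1].
    destruct (HC s t Hs) as [CA2 CB2].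
    assert (Cy : continuity_2d_pt y s t) by now apply continuity_2d_pt_quad.
    assert (Py : 0 < y s t) by now apply quad_pos.
    assert (CR : forall k, continuity_2d_pt (fun s t => Rpower (y s t) k) s t)
      by (intros; now apply continuity_2d_pt_Rpower).
    refine (conj (conj _ _) (conj (conj _ _) (conj (conj _ _) (conj (conj _ _) _)))).
    + apply (is_derive_quad_power a b e k (fun x => A x t) (fun x => B x t)); auto.
    + apply (is_derive_quad_power_2 a b e k (fun x => A x t) (fun x => B x t)
        (fun x => A1 x t) (fun x => B1 x t)); auto.
    + apply (is_derive_quad_power a b e k (fun y => A s y) (fun y => B s y)); auto.
    + apply (is_derive_quad_power_2 a b e k (fun y => A s y) (fun y => B s y)
        (fun y => - B1 s y) (fun y => A1 s y)); auto.
      apply (is_derive_opp (V := R_NormedModule)). exact B1t.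
    + apply CR.
    + unfold D1. continuity_2d. apply CR.
    + unfold D2. continuity_2d; apply CR.
    + unfold D2. continuity_2d; apply CR.
    + unfold D2, lap_density. fold (y s t). ring.
  - intros s Hs. destruct (HP s Hs) as (P1 & P2 & P3 & P4).
    unfold D1, y. now rewrite P1, P2, P3, P4.
Qed.

Lemma backward_period U h :
  (forall s, s < 0 -> U s 0 = U s (2 * PI)) -> 0 < h ->
  forall s, s < 0 -> backward h U s 0 = backward h U s (2 * PI).
Proof. intros H Hh s Hs. unfold backward. rewrite !H by lra. reflexivity. Qed.

Lemma steklov_period U h :
  (forall s, s < 0 -> U s 0 = U s (2 * PI)) -> 0 < h ->
  forall s, s < 0 -> steklov h U s 0 = steklov h U s (2 * PI).
Proof.
  intros H Hh s Hs. unfold steklov. f_equal. apply RInt_ext.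
  intros x. rewrite Rmin_left, Rmax_right by lra. intros Hx. apply H; lra.
Qed.

Lemma steklov_close U h s t c r :
  0 < h -> s < 0 -> (forall x, x < 0 -> continuity_2d_pt U x t) ->
  (forall x, s - h <= x <= s -> Rabs (U x t - c) <= r) -> Rabs (steklov h U s t - c) <= r.
Proof.
  intros Hh Hs HC HB. unfold steklov.
  assert (X : ex_RInt (fun x => U x t) (s - h) s) by (apply ex_RInt_half_plane_1; auto; lra).
  pose proof (abs_RInt_le_const (fun x => U x t - c) (s - h) s r ltac:(lra)
    (ex_RInt_minus (V := R_NormedModule) _ _ _ _ X (ex_RInt_const _ _ _)) HB) as K.
  rewrite (RInt_minus_R (fun x => U x t)) in K by (exact X || apply ex_RInt_const).
  rewrite RInt_const in K. change (scal (s - (s - h)) c) with ((s - (s - h)) * c) in K.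
  replace (RInt (fun x => U x t) (s - h) s / h - c) with
    ((RInt (fun x => U x t) (s - h) s - (s - (s - h)) * c) / h) by (field; lra).
  unfold Rdiv. rewrite Rabs_mult, (Rabs_right (/ h)) by (left; now apply Rinv_0_lt_compat).
  apply (Rmult_le_reg_r h); auto. rewrite Rmult_assoc, Rinv_l by lra. lra.
Qed.

(** * Laplacian densities *)

Lemma Rpower_le_nonneg x y m : 0 <= m -> 0 < x -> x <= y -> Rpower x m <= Rpower y m.
Proof. intros. now apply Rle_Rpower_l. Qed.

Lemma Rpower_le_nonpos x y m : m <= 0 -> 0 < x -> x <= y -> Rpower y m <= Rpower x m.
Proof.
  intros Hm Hx Hy. replace m with (- - m) by ring. rewrite (Rpower_Ropp x), (Rpower_Ropp y).
  apply Rinv_le_contravar. apply exp_pos. apply Rpower_le_nonneg; lra.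
Qed.

Lemma Rpower_succ x m : 0 < x -> Rpower x m = Rpower x (m - 1) * x.
Proof.
  intros Hx. rewrite <- (Rpower_1 x Hx) at 3. rewrite <- Rpower_plus. f_equal; ring.
Qed.

(** Split [(x + y)^m] as [(x + y)^(m-1) * x + (x + y)^(m-1) * y] and use that the power [m - 1] is
    nonincreasing. For [m >= 1] it is nondecreasing and the inequality reverses. With [m = p/2 - 1]
    this is the threshold [p = 4]. *)
Lemma Rpower_subadditive x y m :
  0 < x -> 0 < y -> m <= 1 -> Rpower (x + y) m <= Rpower x m + Rpower y m.
Proof.
  intros Hx Hy Hm. rewrite (Rpower_succ (x + y)), (Rpower_succ x), (Rpower_succ y) by lra.
  pose proof (Rpower_le_nonpos x (x + y) (m - 1) ltac:(lra) Hx ltac:(lra)).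
  pose proof (Rpower_le_nonpos y (x + y) (m - 1) ltac:(lra) Hy ltac:(lra)). nra.
Qed.

Lemma Rpower_superadditive x y m :
  0 < x -> 0 < y -> 1 <= m -> Rpower x m + Rpower y m <= Rpower (x + y) m.
Proof.
  intros Hx Hy Hm. rewrite (Rpower_succ (x + y)), (Rpower_succ x), (Rpower_succ y) by lra.
  pose proof (Rpower_le_nonneg x (x + y) (m - 1) ltac:(lra) Hx ltac:(lra)).
  pose proof (Rpower_le_nonneg y (x + y) (m - 1) ltac:(lra) Hy ltac:(lra)). nra.
Qed.

Lemma lap_density_nonneg a b e k x y :
  0 <= a -> 0 <= b -> 1 <= k -> 0 <= lap_density a b e k x y.
Proof.
  intros. unfold lap_density.
  pose proof (exp_pos ((k - 2) * ln (quad a b e x y))).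
  pose proof (exp_pos ((k - 1) * ln (quad a b e x y))).
  apply Rplus_le_le_0_compat; repeat apply Rmult_le_pos; try lra.
  - left; assumption.
  - pose proof (pow2_ge_0 (a * x)). pose proof (pow2_ge_0 (b * y)). lra.
  - left; assumption.
Qed.

Lemma lap_density_one e x y : lap_density 1 1 e 1 x y = 4 * Rpower (quad 1 1 e x y) 0.
Proof. unfold lap_density. replace (1 - 1) with 0 by ring. ring. Qed.

Lemma Rpower_0 x : Rpower x 0 = 1.
Proof. unfold Rpower. rewrite Rmult_0_l. apply exp_0. Qed.

(** Writing [x^2] as [(x^2 + e) - e] leaves the unregularised density at [x^2 + e], minus an error
    carrying the factor [e]. Its leading coefficient [2k(2k-1)], against [4k^2] in the radial case,
    is what the factor [2k/(2k-1)] balances. *)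
Lemma lap_density_axis e k x y :
  0 < e ->
  lap_density 1 0 e k x y =
    2 * k * (2 * k - 1) * Rpower (x ^ 2 + e) (k - 1)
    - 4 * k * (k - 1) * (e * Rpower (x ^ 2 + e) (k - 2)).
Proof.
  intros He. unfold lap_density, quad.
  replace (1 * x ^ 2 + 0 * y ^ 2 + e) with (x ^ 2 + e) by ring.
  rewrite (Rpower_succ (x ^ 2 + e) (k - 1)) by nra.
  replace (k - 1 - 1) with (k - 2) by ring. ring.
Qed.

Lemma lap_density_swap a b e k x y : lap_density a b e k x y = lap_density b a e k y x.
Proof.
  unfold lap_density, quad. rewrite (Rplus_comm (a * x ^ 2)). ring.
Qed.

Lemma lap_density_radial e k x y :
  0 < e ->
  lap_density 1 1 e k x y =
    4 * k ^ 2 * Rpower (x ^ 2 + y ^ 2 + e) (k - 1)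
    - 4 * k * (k - 1) * (e * Rpower (x ^ 2 + y ^ 2 + e) (k - 2)).
Proof.
  intros He. unfold lap_density, quad.
  replace (1 * x ^ 2 + 1 * y ^ 2 + e) with (x ^ 2 + y ^ 2 + e) by ring.
  rewrite (Rpower_succ (x ^ 2 + y ^ 2 + e) (k - 1)) by nra.
  replace (k - 1 - 1) with (k - 2) by ring. ring.
Qed.

(* Replacing [x^2] by [x^2 + e] loses at most [4 * corrector k e] in the
   Laplacian inequality; adding [corrector k e * (x^2 + y^2)] compensates. *)
Definition corrector (k e : R) : R := 4 * k ^ 2 * (k - 1) / (2 * k - 1) * Rpower e (k - 1).

(** The radial constant [2 * e] makes its base the sum of the two axial bases, so subadditivity
    applies to the leading terms. The radial error has the favourable sign. Each axial error
    contains [e * (z + e)^(k-2)], at most [e^(k-1)] because [k <= 2]; the two together are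
    compensated exactly by [corrector], the Laplacian of [x^2 + y^2] being 4. *)
Lemma lap_density_low k e x y :
  1 <= k <= 2 -> 0 < e ->
  0 <= 2 * k / (2 * k - 1) * (lap_density 1 0 e k x y + lap_density 0 1 e k x y)
       + corrector k e * lap_density 1 1 e 1 x y - lap_density 1 1 (2 * e) k x y.
Proof.
  intros Hk He.
  rewrite (lap_density_swap 0 1), lap_density_one, Rpower_0, !lap_density_axis,
    lap_density_radial by lra.
  assert (Z : forall z, 0 < z + e -> 0 <= z ->
     e * Rpower (z + e) (k - 2) <= Rpower e (k - 1)).
  { intros z Hz Hz0. rewrite (Rpower_succ e (k - 1)) by lra.
    replace (k - 1 - 1) with (k - 2) by ring. rewrite Rmult_comm.
    apply Rmult_le_compat_r. lra. apply Rpower_le_nonpos; lra. }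
  pose proof (Z (x ^ 2) ltac:(nra) ltac:(nra)) as Zx.
  pose proof (Z (y ^ 2) ltac:(nra) ltac:(nra)) as Zy.
  pose proof (Rpower_subadditive (x ^ 2 + e) (y ^ 2 + e) (k - 1) ltac:(nra) ltac:(nra)
    ltac:(lra)) as Sub.
  replace (x ^ 2 + e + (y ^ 2 + e)) with (x ^ 2 + y ^ 2 + 2 * e) in Sub by ring.
  pose proof (exp_pos ((k - 2) * ln (x ^ 2 + y ^ 2 + 2 * e))) as Pw.
  change (0 < Rpower (x ^ 2 + y ^ 2 + 2 * e) (k - 2)) in Pw.
  set (w2 := Rpower (x ^ 2 + y ^ 2 + 2 * e) (k - 2)) in *.
  set (w1 := Rpower (x ^ 2 + y ^ 2 + 2 * e) (k - 1)) in *.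
  set (x1 := Rpower (x ^ 2 + e) (k - 1)) in *. set (y1 := Rpower (y ^ 2 + e) (k - 1)) in *.
  set (x2 := e * Rpower (x ^ 2 + e) (k - 2)) in *.
  set (y2 := e * Rpower (y ^ 2 + e) (k - 2)) in *.
  unfold corrector. set (q := Rpower e (k - 1)) in *.
  replace (2 * k / (2 * k - 1) * _ + _ - _) with
    (4 * k ^ 2 * (x1 + y1 - w1)
     + 8 * k ^ 2 * ((k - 1) / (2 * k - 1)) * ((q - x2) + (q - y2))
     + 4 * k * (k - 1) * (2 * e * w2)) by (field; lra).
  assert (0 <= (k - 1) / (2 * k - 1)).
  { apply Rmult_le_pos. lra. left. apply Rinv_0_lt_compat. lra. }
  assert (0 <= 8 * k ^ 2 * ((k - 1) / (2 * k - 1))) by (apply Rmult_le_pos; nra).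
  assert (0 <= 4 * k ^ 2 * (x1 + y1 - w1)) by (apply Rmult_le_pos; nra).
  assert (0 <= 4 * k * (k - 1) * (2 * e * w2)) by (apply Rmult_le_pos; nra).
  assert (0 <= 8 * k ^ 2 * ((k - 1) / (2 * k - 1)) * ((q - x2) + (q - y2)))
    by (apply Rmult_le_pos; lra).
  lra.
Qed.

(** Here the axial errors have the favourable sign and the radial one does not. With the constant
    [2 * k * e], the radial density is [4 k^2 w2 (x^2 + y^2 + 2 k e - 2 (k-1) e)], so exactly
    [2 * e] survives in the bracket. Lowering the base of [w2] to [x^2 + y^2 + 2 e], possible since
    [k >= 2], leaves a power to which superadditivity applies. *)
Lemma lap_density_high k e x y :
  2 <= k -> 0 < e ->
  0 <= lap_density 1 1 (2 * k * e) k x y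
       - 2 * k / (2 * k - 1) * (lap_density 1 0 e k x y + lap_density 0 1 e k x y).
Proof.
  intros Hk He.
  rewrite (lap_density_swap 0 1), !lap_density_axis, lap_density_radial by nra.
  pose proof (Rpower_superadditive (x ^ 2 + e) (y ^ 2 + e) (k - 1) ltac:(nra) ltac:(nra)
    ltac:(lra)) as Sup.
  replace (x ^ 2 + e + (y ^ 2 + e)) with (x ^ 2 + y ^ 2 + 2 * e) in Sup by ring.
  assert (Hz : 0 < x ^ 2 + y ^ 2 + 2 * e) by nra.
  assert (Hw : x ^ 2 + y ^ 2 + 2 * e <= x ^ 2 + y ^ 2 + 2 * k * e) by nra.
  pose proof (Rpower_le_nonneg _ _ (k - 2) ltac:(lra) Hz Hw) as Mon.
  rewrite (Rpower_succ (x ^ 2 + y ^ 2 + 2 * e) (k - 1)) in Sup by lra.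
  rewrite (Rpower_succ (x ^ 2 + y ^ 2 + 2 * k * e) (k - 1)) by lra.
  replace (k - 1 - 1) with (k - 2) in * by ring.
  pose proof (exp_pos ((k - 2) * ln (x ^ 2 + e))) as Px.
  change (0 < Rpower (x ^ 2 + e) (k - 2)) in Px.
  pose proof (exp_pos ((k - 2) * ln (y ^ 2 + e))) as Py.
  change (0 < Rpower (y ^ 2 + e) (k - 2)) in Py.
  set (w2 := Rpower (x ^ 2 + y ^ 2 + 2 * k * e) (k - 2)) in *.
  set (z2 := Rpower (x ^ 2 + y ^ 2 + 2 * e) (k - 2)) in *.
  set (x1 := Rpower (x ^ 2 + e) (k - 1)) in *. set (y1 := Rpower (y ^ 2 + e) (k - 1)) in *.
  set (x2 := Rpower (x ^ 2 + e) (k - 2)) in *.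
  set (y2 := Rpower (y ^ 2 + e) (k - 2)) in *.
  replace (_ - _ - _) with
    (4 * k ^ 2 * (w2 * (x ^ 2 + y ^ 2 + 2 * e) - (x1 + y1))
     + 8 * k ^ 2 * ((k - 1) / (2 * k - 1)) * (e * x2 + e * y2)) by (field; lra).
  assert (0 <= (k - 1) / (2 * k - 1)).
  { apply Rmult_le_pos. lra. left. apply Rinv_0_lt_compat. lra. }
  assert (0 <= 8 * k ^ 2 * ((k - 1) / (2 * k - 1))) by (apply Rmult_le_pos; nra).
  assert (0 <= 4 * k ^ 2 * (w2 * (x ^ 2 + y ^ 2 + 2 * e) - (x1 + y1)))
    by (apply Rmult_le_pos; nra).
  assert (0 <= 8 * k ^ 2 * ((k - 1) / (2 * k - 1)) * (e * x2 + e * y2))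
    by (apply Rmult_le_pos; nra).
  lra.
Qed.

(** * Continuity at zero and limits in a positive parameter *)

Lemma continuity_pt_powR z k : 0 < k -> 0 <= z -> continuity_pt (fun x => powR x k) z.
Proof.
  intros Hk [Hz | <-].
  - apply (continuity_pt_ext_loc (fun x => Rpower x k)).
    + exists (mkposreal z Hz). intros y Hy. change (Rabs (y - z) < z) in Hy.
      apply Rabs_lt_between in Hy. unfold powR. destruct (Rle_dec y 0); lra.
    + apply continuity_pt_filterlim.
      apply (ex_derive_continuous (V := R_NormedModule) (fun y => Rpower y k) z).
      eexists. now apply is_derive_Rpower.
  - intros eps Heps. exists (Rpower eps (/ k)). split. { apply exp_pos. }
    intros x [_ Hx]. simpl in *. unfold R_dist in *. rewrite Rminus_0_r in Hx.
    apply Rabs_lt_between in Hx.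
    unfold powR. destruct (Rle_dec 0 0) as [_|]; [|lra]. rewrite Rminus_0_r.
    destruct (Rle_dec x 0). { rewrite Rabs_R0. lra. }
    rewrite Rabs_right by (left; apply exp_pos).
    replace eps with (Rpower (Rpower eps (/ k)) k).
    + apply Rlt_Rpower_l; lra.
    + rewrite Rpower_mult, Rinv_l, Rpower_1; lra.
Qed.

Lemma powR_Rpower z k : 0 < z -> powR z k = Rpower z k.
Proof. intros. unfold powR. destruct (Rle_dec z 0); lra. Qed.

(** Continuity is asked for along the segment [x = 0] only, where compactness of [a, b] makes it
    uniform in [t]; integrability for [x > 0] is therefore a separate hypothesis. *)
Lemma RInt_limit (F : R -> R -> R) a b d :
  a <= b -> 0 < d ->
  (forall t, a <= t <= b -> continuity_2d_pt F 0 t) ->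
  (forall x, 0 < x < d -> ex_RInt (F x) a b) ->
  limit1_in (fun x => RInt (F x) a b) (fun x => 0 < x) (RInt (F 0) a b) 0.
Proof.
  intros Hab Hd HC HX.
  assert (X0 : ex_RInt (F 0) a b).
  { apply (@ex_RInt_continuous R_CompleteNormedModule).
    intros z Hz. rewrite Rmin_left, Rmax_right in Hz by lra.
    apply (continuity_2d_pt_continuous_2 F). auto. }
  intros eps Heps.
  (* The summand 1 keeps the quotient meaningful when [a = b] and the final inequality strict. *)
  assert (He : 0 < eps / (b - a + 1)) by (apply Rdiv_lt_0_compat; lra).
  destruct (uniform_continuity_2d_1d' F a b 0 HC (mkposreal _ He)) as [r Hr].
  exists (Rmin d r). split. { apply Rmin_glb_lt; auto. apply cond_pos. }
  intros x [Hx0 Hx]. simpl in *. unfold R_dist in *. rewrite Rminus_0_r in Hx.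
  rewrite Rabs_right in Hx by lra.
  pose proof (Rmin_l d r). pose proof (Rmin_r d r).
  rewrite <- (RInt_minus_R (F x) (F 0)) by (auto; apply HX; lra).
  eapply Rle_lt_trans.
  - apply (abs_RInt_le_const _ a b (eps / (b - a + 1))); auto.
    + apply (ex_RInt_minus (V := R_NormedModule)); auto. apply HX; lra.
    + intros t Ht. left. apply Hr; auto; try lra.
      rewrite Rminus_diag, Rabs_R0. apply cond_pos.
  - apply Rmult_lt_reg_r with (b - a + 1); [lra|]. field_simplify; nra.
Qed.

Lemma limit1_in_le (f g : R -> R) l l' d :
  0 < d ->
  limit1_in f (fun x => 0 < x) l 0 -> limit1_in g (fun x => 0 < x) l' 0 ->
  (forall x, 0 < x < d -> f x <= g x) -> l <= l'.
Proof.
  intros Hd Hf Hg H. apply Rnot_lt_le. intros Hl.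
  destruct (Hf ((l - l') / 2)) as (d1 & Hd1 & F1); [lra|].
  destruct (Hg ((l - l') / 2)) as (d2 & Hd2 & F2); [lra|].
  set (x := Rmin d (Rmin d1 d2) / 2).
  pose proof (Rmin_l d (Rmin d1 d2)). pose proof (Rmin_r d (Rmin d1 d2)).
  pose proof (Rmin_l d1 d2). pose proof (Rmin_r d1 d2).
  assert (0 < Rmin d (Rmin d1 d2)) by (repeat apply Rmin_glb_lt; lra).
  assert (Hx : 0 < x < d) by (unfold x; lra).
  simpl in *. unfold R_dist in *.
  assert (Ax : Rabs (x - 0) = x) by (rewrite Rminus_0_r; apply Rabs_right; lra).
  specialize (F1 x). specialize (F2 x). rewrite Ax in F1, F2.
  specialize (F1 ltac:(unfold x; lra)). specialize (F2 ltac:(unfold x; lra)).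
  apply Rabs_lt_between in F1. apply Rabs_lt_between in F2. specialize (H x Hx). lra.
Qed.

(** * Monotonicity of the means in logarithmic coordinates *)

Definition equal_at_period (U : R -> R -> R) : Prop :=
  forall s, s < 0 -> U s 0 = U s (2 * PI).

Definition bounded_at_minus_infinity (U : R -> R -> R) : Prop :=
  exists S K, forall s t, s < S -> Rabs (U s t) <= K.

(* [U + iV] behaves like [f (exp (s + i t))] for [f] holomorphic on the disk. *)
Definition log_holomorphic (U V U' V' : R -> R -> R) : Prop :=
  cauchy_riemann U V U' V' /\
  (equal_at_period U /\ equal_at_period V) /\
  (bounded_at_minus_infinity U /\ bounded_at_minus_infinity V).

Definition smooth (h : R) (U : R -> R -> R) : R -> R -> R := steklov h (steklov h U).

(** An average stays in every closed interval containing the averaged values, and two windows of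
    length [h] reach back to [s - 2 * h]. With [c = 0] this transfers bounds to [smooth]; with [c] a
    value of [U] or [V] it gives convergence as [h] tends to 0. *)
Lemma smooth_close U V U' V' h s t c r :
  cauchy_riemann U V U' V' -> 0 < h -> s < 0 ->
  ((forall x, s - 2 * h <= x <= s -> Rabs (U x t - c) <= r) -> Rabs (smooth h U s t - c) <= r) /\
  ((forall x, s - 2 * h <= x <= s -> Rabs (V x t - c) <= r) -> Rabs (smooth h V s t - c) <= r).
Proof.
  intros H Hh Hs. pose proof (cauchy_riemann_steklov _ _ _ _ h Hh H) as H'.
  split; intros HB; unfold smooth;
    (apply steklov_close; auto; [intros; now apply (cauchy_riemann_continuity _ _ _ _ _ _ H') |
     intros x Hx; apply steklov_close; auto; try lra;
     [intros; now apply (cauchy_riemann_continuity _ _ _ _ _ _ H) |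
      intros; apply HB; lra]]).
Qed.

Lemma smooth_bounded U V U' V' h :
  log_holomorphic U V U' V' -> 0 < h ->
  bounded_at_minus_infinity (smooth h U) /\ bounded_at_minus_infinity (smooth h V).
Proof.
  intros (H & _ & (S1 & K1 & B1) & (S2 & K2 & B2)) Hh.
  split; [exists (Rmin S1 0), K1 | exists (Rmin S2 0), K2]; intros s t Hs;
    pose proof (Rmin_l S1 0); pose proof (Rmin_r S1 0);
    pose proof (Rmin_l S2 0); pose proof (Rmin_r S2 0).
  - destruct (smooth_close U V U' V' h s t 0 K1 H Hh ltac:(lra)) as [C _].
    rewrite Rminus_0_r in C. apply C. intros x Hx. rewrite Rminus_0_r. apply B1; lra.
  - destruct (smooth_close U V U' V' h s t 0 K2 H Hh ltac:(lra)) as [_ C].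
    rewrite Rminus_0_r in C. apply C. intros x Hx. rewrite Rminus_0_r. apply B2; lra.
Qed.

(* [w] stands for [|g'|^2], common to all the powers that are combined. *)
Definition weighted_C2 (w E D : R -> R -> R) : Prop :=
  periodic_C2 E (fun s t => w s t * D s t) /\ bounded_at_minus_infinity E.

Lemma periodic_C2_ext E L L' :
  (forall s t, L s t = L' s t) -> periodic_C2 E L -> periodic_C2 E L'.
Proof.
  intros HL (Es & Ess & Et & Ett & H & P). exists Es, Ess, Et, Ett. split; auto.
  intros s t Hs. rewrite <- HL. auto.
Qed.

Lemma weighted_C2_lincomb w E D E' D' c d :
  weighted_C2 w E D -> weighted_C2 w E' D' ->
  weighted_C2 w (fun s t => c * E s t + d * E' s t) (fun s t => c * D s t + d * D' s t).
Proof.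
  intros [H1 (S1 & K1 & B1)] [H2 (S2 & K2 & B2)]. split.
  - eapply periodic_C2_ext; [| exact (periodic_C2_lincomb _ _ _ _ c d H1 H2)].
    intros s t. simpl. ring.
  - exists (Rmin S1 S2), (Rabs c * K1 + Rabs d * K2). intros s t Hs.
    pose proof (Rmin_l S1 S2). pose proof (Rmin_r S1 S2).
    eapply Rle_trans. apply Rabs_triang. rewrite !Rabs_mult.
    apply Rplus_le_compat; (apply Rmult_le_compat_l; [apply Rabs_pos |]).
    apply B1; lra. apply B2; lra.
Qed.

Lemma weighted_C2_nondecreasing w E D s1 s2 :
  weighted_C2 w E D -> (forall s t, 0 <= w s t) -> (forall s t, 0 <= D s t) ->
  s1 <= s2 -> s2 < 0 -> circle_int E s1 <= circle_int E s2.
Proof.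
  intros [H (S & K & B)] Hw HD. apply (circle_int_nondecreasing E _ K S H).
  - intros s t _. now apply Rmult_le_pos.
  - intros s t Hs. eapply Rle_trans. apply Rle_abs. now apply B.
Qed.

Lemma weighted_C2_ex_RInt w E D s :
  weighted_C2 w E D -> s < 0 -> ex_RInt (E s) 0 (2 * PI).
Proof.
  intros [(Es & Ess & Et & Ett & H & _) _] Hs. apply (ex_RInt_half_plane_2 E).
  intros t. apply (H s t Hs).
Qed.

Lemma circle_int_lincomb w E D E' D' c d s :
  weighted_C2 w E D -> weighted_C2 w E' D' -> s < 0 ->
  circle_int (fun s t => c * E s t + d * E' s t) s = c * circle_int E s + d * circle_int E' s.
Proof.
  intros H1 H2 Hs. apply is_RInt_unique.
  apply (is_RInt_plus (V := R_NormedModule)); apply (is_RInt_scal (V := R_NormedModule));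
  apply (RInt_correct (V := R_CompleteNormedModule)); eapply weighted_C2_ex_RInt; eauto.
Qed.

(** The squared modulus of the derivative of [smooth h U + i smooth h V]: by
    [cauchy_riemann_steklov], the outer average differentiates to a difference quotient of the inner
    one. *)
Definition smooth_weight (h : R) (U V : R -> R -> R) (s t : R) : R :=
  backward h (steklov h U) s t ^ 2 + backward h (steklov h V) s t ^ 2.

(** The first derivative of the double average is a difference quotient of the single average
    ([H2]), and the second derivative is an iterated difference quotient of [U] and [V] themselves
    ([H3]), hence continuous. *)
Lemma smooth_quad_power_C2 U V U' V' h a b e k :
  log_holomorphic U V U' V' -> 0 < h -> 0 <= a -> 0 <= b -> 0 < e -> 0 <= k ->
  weighted_C2 (smooth_weight h U V)
    (quad_power a b e k (smooth h U) (smooth h V))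
    (fun s t => lap_density a b e k (smooth h U s t) (smooth h V s t)).
Proof.
  intros HH Hh Ha Hb He Hk. destruct (smooth_bounded _ _ _ _ _ HH Hh)
    as [(S1 & K1 & B1) (S2 & K2 & B2)].
  destruct HH as (H & (PU & PV) & _).
  pose proof (cauchy_riemann_steklov _ _ _ _ h Hh H) as H1.
  pose proof (cauchy_riemann_steklov _ _ _ _ h Hh H1) as H2.
  pose proof (cauchy_riemann_backward _ _ _ _ h Hh H1) as H3.
  split.
  - apply (quad_power_C2 _ _ _ _ _ _ a b e k H2 H3); auto.
    + intros s t Hs. destruct (cauchy_riemann_continuity _ _ _ _ s t H Hs).
      destruct (cauchy_riemann_continuity _ _ _ _ (s - h) t H ltac:(lra)).
      destruct (cauchy_riemann_continuity _ _ _ _ (s - h - h) t H ltac:(lra)).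
      split; repeat apply continuity_2d_pt_backward; assumption.
    + intros s Hs.
      repeat match goal with |- _ /\ _ => split end;
      (apply steklov_period || apply backward_period); auto;
      intros; apply steklov_period; auto.
  - exists (Rmin S1 S2), (Rpower (a * K1 ^ 2 + b * K2 ^ 2 + e) k). intros s t Hs.
    pose proof (Rmin_l S1 S2). pose proof (Rmin_r S1 S2).
    specialize (B1 s t ltac:(lra)). specialize (B2 s t ltac:(lra)).
    unfold quad_power. rewrite Rabs_right by (left; apply exp_pos).
    apply Rpower_le_nonneg; auto. now apply quad_pos.
    unfold quad. apply Rplus_le_compat_r, Rplus_le_compat; apply Rmult_le_compat_l; auto.
    + rewrite <- (pow2_abs (smooth h U s t)). apply pow_incr. split; auto. apply Rabs_pos.
    + rewrite <- (pow2_abs (smooth h V s t)). apply pow_incr. split; auto. apply Rabs_pos.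
Qed.

(** The family is continued by the original function for [h <= 0], because [continuity_2d_pt] looks
    at both sides of [h = 0]. *)
Lemma continuity_2d_pt_smooth_limit U V U' V' s t :
  cauchy_riemann U V U' V' -> s < 0 ->
  continuity_2d_pt (fun h y => if Rlt_dec 0 h then smooth h U s y else U s y) 0 t /\
  continuity_2d_pt (fun h y => if Rlt_dec 0 h then smooth h V s y else V s y) 0 t.
Proof.
  intros H Hs. destruct (cauchy_riemann_continuity _ _ _ _ s t H Hs) as [CU CV].
  split; intros eps;
  assert (He : 0 < eps / 2) by (pose proof (cond_pos eps); lra);
  [destruct (CU (mkposreal _ He)) as [d Hd] | destruct (CV (mkposreal _ He)) as [d Hd]];
  (* The window of [smooth h] has length [2 * h], so [h < d / 2] keeps it within [d] of [s]. *)
  assert (Hd2 : 0 < d / 2) by (pose proof (cond_pos d); lra);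
  exists (mkposreal _ Hd2); intros h y Hh Hy; simpl in *; rewrite Rminus_0_r in Hh;
  (destruct (Rlt_dec 0 0); [lra|]); apply Rle_lt_trans with (eps / 2);
  try (pose proof (cond_pos eps); lra);
  (destruct (Rlt_dec 0 h) as [Hp|]; [| left; apply Hd; try lra; rewrite Rminus_diag, Rabs_R0; lra]);
  rewrite Rabs_right in Hh by lra.
  - destruct (smooth_close U V U' V' h s y (U s t) (eps / 2) H Hp Hs) as [C _].
    apply C. intros x Hx. left. apply Hd; try lra. apply Rabs_lt_between; lra.
  - destruct (smooth_close U V U' V' h s y (V s t) (eps / 2) H Hp Hs) as [_ C].
    apply C. intros x Hx. left. apply Hd; try lra. apply Rabs_lt_between; lra.
Qed.

(** With [k = p/2], the pairs (1, 0), (0, 1) and (1, 1) for [(a, b)] give |U|^p, |V|^p and |U +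
    iV|^p. The base may vanish, hence [powR]. *)
Definition energy (a b k : R) (U V : R -> R -> R) (s t : R) : R :=
  powR (a * U s t ^ 2 + b * V s t ^ 2) k.

(** Tying the additive constant to the window length as [m * h] removes both regularisations in one
    limit. The factor [m] leaves room for the different constants required by [lap_density_low] and
    [lap_density_high]. *)
Lemma quad_power_limit U V U' V' a b m k s :
  log_holomorphic U V U' V' -> 0 <= a -> 0 <= b -> 0 < m -> 0 < k -> s < 0 ->
  limit1_in (fun h => circle_int (quad_power a b (m * h) k (smooth h U) (smooth h V)) s)
    (fun h => 0 < h) (circle_int (energy a b k U V) s) 0.
Proof.
  intros HH Ha Hb Hm Hk Hs.
  set (A := fun h y => if Rlt_dec 0 h then smooth h U s y else U s y).
  set (B := fun h y => if Rlt_dec 0 h then smooth h V s y else V s y).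
  set (F := fun h y => powR (quad a b (m * h) (A h y) (B h y)) k).
  assert (F0 : RInt (F 0) 0 (2 * PI) = circle_int (energy a b k U V) s).
  { apply RInt_ext. intros y _. unfold F, A, B, energy, quad.
    destruct (Rlt_dec 0 0); [lra|]. f_equal. ring. }
  assert (Fh : forall h y, 0 < h ->
     quad_power a b (m * h) k (smooth h U) (smooth h V) s y = F h y).
  { intros h y Hh. unfold F, A, B, quad_power.
    destruct (Rlt_dec 0 h); [|lra]. rewrite powR_Rpower; auto. apply quad_pos; auto. nra. }
  rewrite <- F0.
  assert (LF : limit1_in (fun h => RInt (F h) 0 (2 * PI)) (fun h => 0 < h)
    (RInt (F 0) 0 (2 * PI)) 0).
  { apply (RInt_limit F 0 (2 * PI) 1); try lra.
    - pose proof PI_RGT_0; lra.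
    - intros t _. destruct HH as (H & _).
      destruct (continuity_2d_pt_smooth_limit U V U' V' s t H Hs) as [CA CB].
      fold A in CA. fold B in CB.
      apply (continuity_1d_2d_pt_comp (fun z => powR z k)
        (fun h y => quad a b (m * h) (A h y) (B h y))).
      + apply continuity_pt_powR; auto. unfold quad. rewrite Rmult_0_r. nra.
      + unfold quad. continuity_2d. apply continuity_2d_pt_id1.
    - intros h Hh. apply (ex_RInt_ext (quad_power a b (m * h) k (smooth h U) (smooth h V) s)).
      + intros y _. apply Fh. lra.
      + eapply weighted_C2_ex_RInt; [eapply smooth_quad_power_C2 |]; eauto; try lra; nra. }
  intros eps Heps. destruct (LF eps Heps) as (d & Hd & HL). exists d. split; auto.
  intros h [Hh1 Hh2]. specialize (HL h (conj Hh1 Hh2)).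
  replace (circle_int _ s) with (RInt (F h) 0 (2 * PI)); auto.
  apply RInt_ext. intros y _. symmetry. now apply Fh.
Qed.

Lemma corrector_limit k : 1 <= k -> limit1_in (corrector k) (fun h => 0 < h) 0 0.
Proof.
  intros Hk. unfold corrector.
  (* At [k = 1] the power of [e] is constantly 1, and it is the factor [k - 1] that makes the
     corrector vanish. *)
  destruct (Req_dec k 1) as [-> | Hk1].
  - intros eps Heps. exists 1. split; [lra|]. intros x _. simpl. unfold R_dist.
    replace (_ - 0) with 0. now rewrite Rabs_R0. field.
  - set (c := 4 * k ^ 2 * (k - 1) / (2 * k - 1)).
    assert (E0 : c * powR 0 (k - 1) = 0).
    { unfold powR. destruct (Rle_dec 0 0); [ring|lra]. }
    assert (L : limit1_in (fun h => powR h (k - 1)) (fun h => 0 < h) (powR 0 (k - 1)) 0).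
    { intros eps Heps.
      destruct (continuity_pt_powR 0 (k - 1) ltac:(lra) ltac:(lra) eps Heps) as (d & Hd & H).
      exists d. split; auto. intros x [Hx1 Hx2]. apply H. split; auto.
      split. exact I. lra. }
    assert (Lc : limit1_in (fun _ => c) (fun h => 0 < h) c 0) by exact (limit_free (fun _ => c) _ 0 0).
    pose proof (limit_mul _ _ _ _ _ _ Lc L) as LL. rewrite E0 in LL.
    intros eps Heps. destruct (LL eps Heps) as (d & Hd & H).
    exists d. split; auto. intros x [Hx1 Hx2]. rewrite <- powR_Rpower by auto. apply H; auto.
Qed.

Lemma limit1_in_lincomb f g D l l' x c d :
  limit1_in f D l x -> limit1_in g D l' x ->
  limit1_in (fun y => c * f y + d * g y) D (c * l + d * l') x.
Proof.
  intros Hf Hg. apply limit_plus; apply limit_mul; auto.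
  exact (limit_free (fun _ => c) D 0 x). exact (limit_free (fun _ => d) D 0 x).
Qed.

(** Nonnegativity of [lap_density] for [k >= 1] survives the limit. Monotonicity of the single means
    is what later allows the suprema for [u] and [v] to be approached along common radii. *)
Lemma energy_nondecreasing U V U' V' a b k s1 s2 :
  log_holomorphic U V U' V' -> 0 <= a -> 0 <= b -> 1 <= k -> s1 <= s2 -> s2 < 0 ->
  circle_int (energy a b k U V) s1 <= circle_int (energy a b k U V) s2.
Proof.
  intros HH Ha Hb Hk H12 H2.
  apply (limit1_in_le _ _ _ _ 1 ltac:(lra)
    (quad_power_limit U V U' V' a b 1 k s1 HH Ha Hb ltac:(lra) ltac:(lra) ltac:(lra))
    (quad_power_limit U V U' V' a b 1 k s2 HH Ha Hb ltac:(lra) ltac:(lra) ltac:(lra))).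
  intros h Hh. eapply weighted_C2_nondecreasing; auto.
  - apply smooth_quad_power_C2 with (U' := U') (V' := V'); auto; lra.
  - intros s t. unfold smooth_weight. nra.
  - intros s t. now apply lap_density_nonneg.
Qed.

Definition riesz_gap (k : R) (U V : R -> R -> R) (s : R) : R :=
  2 * k / (2 * k - 1) * (circle_int (energy 1 0 k U V) s + circle_int (energy 0 1 k U V) s)
  - circle_int (energy 1 1 k U V) s.

(** The gap is monotone after regularisation and addition of the corrector term. That term
    multiplies a convergent integral by a coefficient tending to 0, so it disappears in the
    limit. *)
Lemma riesz_gap_nondecreasing U V U' V' k s1 s2 :
  log_holomorphic U V U' V' -> 1 <= k <= 2 -> s1 <= s2 -> s2 < 0 ->
  riesz_gap k U V s1 <= riesz_gap k U V s2.
Proof.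
  intros HH Hk H12 H2. set (c := 2 * k / (2 * k - 1)).
  set (Q := fun a b e k h => quad_power a b e k (smooth h U) (smooth h V)).
  (* The nesting and the factors 1 and -1 reproduce three uses of [weighted_C2_lincomb]; the
     constants [1 * h] and [2 * h] are those of [lap_density_low]. *)
  set (G := fun h s =>
    1 * (1 * (c * circle_int (Q 1 0 (1 * h) k h) s + c * circle_int (Q 0 1 (1 * h) k h) s)
    + corrector k h * circle_int (Q 1 1 (1 * h) 1 h) s) + (-1) * circle_int (Q 1 1 (2 * h) k h) s).
  assert (L : forall s, s < 0 -> limit1_in (fun h => G h s) (fun h => 0 < h) (riesz_gap k U V s) 0).
  { intros s Hs.
    replace (riesz_gap k U V s) with
     (1 * (1 * (c * circle_int (energy 1 0 k U V) s + c * circle_int (energy 0 1 k U V) s)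
      + 1 * (0 * circle_int (energy 1 1 1 U V) s)) + (-1) * circle_int (energy 1 1 k U V) s)
      by (unfold riesz_gap, c; ring).
    apply limit1_in_lincomb; [apply limit_plus; [|rewrite Rmult_1_l; apply limit_mul] |].
    - rewrite Rmult_1_l.
      assert (X : limit1_in (fun h => c * circle_int (Q 1 0 (1 * h) k h) s +
         c * circle_int (Q 0 1 (1 * h) k h) s) (fun h => 0 < h) (c * circle_int (energy 1 0 k U V) s + c * circle_int (energy 0 1 k U V) s) 0).
      { apply limit1_in_lincomb; apply (quad_power_limit U V U' V'); auto; lra. }
      intros eps Heps. destruct (X eps Heps) as (d & Hd & HX). exists d. split; auto.
      intros x Hx. rewrite Rmult_1_l. now apply HX.
    - apply corrector_limit; lra.
    - apply (quad_power_limit U V U' V'); auto; lra.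
    - apply (quad_power_limit U V U' V'); auto; lra. }
  apply (limit1_in_le _ _ _ _ 1 ltac:(lra) (L s1 ltac:(lra)) (L s2 H2)).
  intros h Hh.
  assert (W : forall a b e k, 0 <= a -> 0 <= b -> 0 < e -> 0 <= k ->
    weighted_C2 (smooth_weight h U V) (Q a b e k h)
    (fun s t => lap_density a b e k (smooth h U s t) (smooth h V s t))).
  { intros. apply smooth_quad_power_C2 with (U' := U') (V' := V'); auto; lra. }
  pose proof (W 1 0 (1 * h) k ltac:(lra) ltac:(lra) ltac:(lra) ltac:(lra)) as W1.
  pose proof (W 0 1 (1 * h) k ltac:(lra) ltac:(lra) ltac:(lra) ltac:(lra)) as W2.
  pose proof (W 1 1 (1 * h) 1 ltac:(lra) ltac:(lra) ltac:(lra) ltac:(lra)) as W3.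
  pose proof (W 1 1 (2 * h) k ltac:(lra) ltac:(lra) ltac:(lra) ltac:(lra)) as W4.
  pose proof (weighted_C2_lincomb _ _ _ _ _ c c W1 W2) as W12.
  pose proof (weighted_C2_lincomb _ _ _ _ _ 1 (corrector k h) W12 W3) as W123.
  pose proof (weighted_C2_lincomb _ _ _ _ _ 1 (-1) W123 W4) as W1234.
  assert (EG : forall s, s < 0 -> G h s = circle_int (fun s t => 1 * (1 * (c * Q 1 0 (1 * h) k h s t
    + c * Q 0 1 (1 * h) k h s t) + corrector k h * Q 1 1 (1 * h) 1 h s t) + (-1) * Q 1 1 (2 * h) k h s t) s).
  { intros s Hs. unfold G.
    pose proof (circle_int_lincomb _ _ _ _ _ c c s W1 W2 Hs) as E12.
    pose proof (circle_int_lincomb _ _ _ _ _ 1 (corrector k h) s W12 W3 Hs) as E123.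
    pose proof (circle_int_lincomb _ _ _ _ _ 1 (-1) s W123 W4 Hs) as E1234.
    cbv beta in E12, E123, E1234. now rewrite E1234, E123, E12. }
  rewrite !EG by lra.
  apply (weighted_C2_nondecreasing _ _ _ _ _ W1234); auto.
  - intros s t. unfold smooth_weight. nra.
  - intros s t. rewrite !Rmult_1_l.
    pose proof (lap_density_low k h (smooth h U s t) (smooth h V s t) Hk ltac:(lra)).
    fold c in H. lra.
Qed.

Lemma riesz_gap_nonincreasing U V U' V' k s1 s2 :
  log_holomorphic U V U' V' -> 2 <= k -> s1 <= s2 -> s2 < 0 ->
  riesz_gap k U V s2 <= riesz_gap k U V s1.
Proof.
  intros HH Hk H12 H2. set (c := 2 * k / (2 * k - 1)).
  set (Q := fun a b e k h => quad_power a b e k (smooth h U) (smooth h V)).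
  (* The regularised gap with reversed sign, so that its density is nonnegative; [2 * k * h] is the
     radial constant of [lap_density_high]. *)
  set (G := fun h s =>
    1 * circle_int (Q 1 1 (2 * k * h) k h) s +
    (-1) * (c * circle_int (Q 1 0 (1 * h) k h) s + c * circle_int (Q 0 1 (1 * h) k h) s)).
  assert (L : forall s, s < 0 -> limit1_in (fun h => G h s) (fun h => 0 < h) (- riesz_gap k U V s) 0).
  { intros s Hs.
    replace (- riesz_gap k U V s) with
     (1 * circle_int (energy 1 1 k U V) s +
      (-1) * (c * circle_int (energy 1 0 k U V) s + c * circle_int (energy 0 1 k U V) s))
      by (unfold riesz_gap, c; ring).
    repeat apply limit1_in_lincomb; apply (quad_power_limit U V U' V'); auto; lra. }
  apply Ropp_le_cancel.
  apply (limit1_in_le _ _ _ _ 1 ltac:(lra) (L s1 ltac:(lra)) (L s2 H2)).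
  intros h Hh.
  assert (W : forall a b e k, 0 <= a -> 0 <= b -> 0 < e -> 0 <= k ->
    weighted_C2 (smooth_weight h U V) (Q a b e k h)
    (fun s t => lap_density a b e k (smooth h U s t) (smooth h V s t))).
  { intros. apply smooth_quad_power_C2 with (U' := U') (V' := V'); auto; lra. }
  pose proof (W 1 0 (1 * h) k ltac:(lra) ltac:(lra) ltac:(lra) ltac:(lra)) as W1.
  pose proof (W 0 1 (1 * h) k ltac:(lra) ltac:(lra) ltac:(lra) ltac:(lra)) as W2.
  pose proof (W 1 1 (2 * k * h) k ltac:(lra) ltac:(lra) ltac:(nra) ltac:(lra)) as W3.
  pose proof (weighted_C2_lincomb _ _ _ _ _ c c W1 W2) as W12.
  pose proof (weighted_C2_lincomb _ _ _ _ _ 1 (-1) W3 W12) as W123.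
  assert (EG : forall s, s < 0 -> G h s = circle_int (fun s t => 1 * Q 1 1 (2 * k * h) k h s t
    + (-1) * (c * Q 1 0 (1 * h) k h s t + c * Q 0 1 (1 * h) k h s t)) s).
  { intros s Hs. unfold G.
    pose proof (circle_int_lincomb _ _ _ _ _ c c s W1 W2 Hs) as E12.
    pose proof (circle_int_lincomb _ _ _ _ _ 1 (-1) s W3 W12 Hs) as E123.
    cbv beta in E12, E123. now rewrite E123, E12. }
  rewrite !EG by lra.
  apply (weighted_C2_nondecreasing _ _ _ _ _ W123); auto.
  - intros s t. unfold smooth_weight. nra.
  - intros s t. rewrite !Rmult_1_l.
    pose proof (lap_density_high k h (smooth h U s t) (smooth h V s t) Hk ltac:(lra)).
    fold c in H. lra.
Qed.

(** * Holomorphic functions on the disk *)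

Lemma is_derive_C_differentiable (f : C -> C) (x y : R) (l : C) :
  @is_derive C_AbsRing C_NormedModule f (x, y) l ->
  differentiable_pt_lim (fun u v => Re (f (u, v))) x y (Re l) (- Im l) /\
  differentiable_pt_lim (fun u v => Im (f (u, v))) x y (Im l) (Re l).
Proof.
  intros [_ H]. specialize (H (x, y) (fun P HP => HP)).
  assert (K : forall eps : posreal, locally_2d (fun u v =>
    Cmod (Cminus (Cminus (f (u, v)) (f (x, y))) (Cmult (u - x, v - y) l)) <=
    eps * Rmax (Rabs (u - x)) (Rabs (v - y))) x y).
  { intros eps.
    (* Complex differentiability is measured by [Cmod], the real notion by the maximum of the
       coordinates. They differ by a factor of at most sqrt 2, bounded here by 2, whence the halves
       of [eps] and of [d]. *)
    assert (He : 0 < eps / 2) by (pose proof (cond_pos eps); lra).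
    destruct (H (mkposreal _ He)) as [d Hd].
    assert (Hd2 : 0 < d / 2) by (pose proof (cond_pos d); lra).
    assert (Cm : forall u v, Cmod (u - x, v - y) <= 2 * Rmax (Rabs (u - x)) (Rabs (v - y))).
    { intros u v. eapply Rle_trans. apply Cmod_2Rmax. simpl.
      apply Rmult_le_compat_r.
      - eapply Rle_trans; [apply Rabs_pos | apply Rmax_l].
      - pose proof (sqrt_pos 2). pose proof (sqrt_sqrt 2 ltac:(lra)). nra. }
    exists (mkposreal _ Hd2). intros u v Hu Hv. simpl in Hu, Hv.
    specialize (Hd (u, v)). specialize (Cm u v).
    eapply Rle_trans; [apply Hd |].
    - change (Cmod (u - x, v - y) < d). eapply Rle_lt_trans; [exact Cm|].
      assert (Rmax (Rabs (u - x)) (Rabs (v - y)) < d / 2) by now apply Rmax_lub_lt.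
      lra.
    - change (eps / 2 * Cmod (u - x, v - y) <= eps * Rmax (Rabs (u - x)) (Rabs (v - y))).
      pose proof (cond_pos eps). nra. }
  split; intros eps; destruct (K eps) as [d Hd]; exists d; intros u v Hu Hv;
    (eapply Rle_trans; [| apply Hd; assumption]);
    (eapply Rle_trans; [| apply Rmax_Cmod]).
  - eapply Rle_trans; [| apply Rmax_l]. right. f_equal.
    destruct (f (u, v)), (f (x, y)), l. simpl. ring.
  - eapply Rle_trans; [| apply Rmax_r]. right. f_equal.
    destruct (f (u, v)), (f (x, y)), l. simpl. ring.
Qed.

Lemma differentiable_pt_lim_partials (F Fx : R -> R -> R) x y fy :
  (forall u v, is_derive (fun z => F z v) u (Fx u v)) ->
  is_derive (fun z => F x z) y fy -> continuity_2d_pt Fx x y ->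
  differentiable_pt_lim F x y (Fx x y) fy.
Proof.
  intros H1 H2 HC. apply filterdiff_differentiable_pt_lim.
  apply (is_derive_filterdiff F x y Fx fy); auto.
  - apply filter_forall. intros u. apply H1.
  - apply (proj1 (continuity_2d_pt_filterlim Fx x y)). exact HC.
Qed.

Lemma continuity_2d_pt_exp_mult (g : R -> R) s t :
  continuity_pt g t -> continuity_2d_pt (fun x y => exp x * g y) s t.
Proof.
  intros Hg. apply continuity_2d_pt_mult.
  - apply (continuity_1d_2d_pt_comp exp). apply derivable_continuous_pt, derivable_pt_exp.
    apply continuity_2d_pt_id1.
  - apply (continuity_1d_2d_pt_comp g); auto. apply continuity_2d_pt_id2.
Qed.

Lemma differentiable_polar s t :
  differentiable_pt_lim (fun x y => exp x * cos y) s t (exp s * cos t) (- (exp s * sin t)) /\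
  differentiable_pt_lim (fun x y => exp x * sin y) s t (exp s * sin t) (exp s * cos t).
Proof.
  split; apply (differentiable_pt_lim_partials _ (fun x y => exp x * _ y)).
  - intros u v. auto_derive; auto. ring.
  - auto_derive; auto. ring.
  - apply continuity_2d_pt_exp_mult, continuity_cos.
  - intros u v. auto_derive; auto. ring.
  - auto_derive; auto. ring.
  - apply continuity_2d_pt_exp_mult, continuity_sin.
Qed.

Lemma Cmod_polar r t : 0 <= r -> Cmod (polar r t) = r.
Proof.
  intros Hr. unfold Cmod, polar. simpl.
  replace (_ + _) with (r ^ 2 * (sin t * sin t + cos t * cos t)) by ring.
  pose proof (sin2_cos2 t) as E. unfold Rsqr in E. rewrite E, Rmult_1_r.
  apply sqrt_pow2. exact Hr.
Qed.

Definition log_re (f : C -> C) (s t : R) : R := Re (f (polar (exp s) t)).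
Definition log_im (f : C -> C) (s t : R) : R := Im (f (polar (exp s) t)).

Lemma log_differentiable f s t :
  holomorphic_on_disk f -> s < 0 -> exists p q,
  differentiable_pt_lim (log_re f) s t p (- q) /\ differentiable_pt_lim (log_im f) s t q p.
Proof.
  intros Hf Hs.
  destruct (Hf (polar (exp s) t)) as [l Hl].
  { rewrite Cmod_polar by (left; apply exp_pos). rewrite <- exp_0. now apply exp_increasing. }
  apply is_derive_C_differentiable in Hl. destruct Hl as [H1 H2].
  destruct (differentiable_polar s t) as [P1 P2].
  (* Real and imaginary parts of [l * exp (s + i t)], the chain rule for [f (exp z)]. *)
  exists (Re l * (exp s * cos t) + - Im l * (exp s * sin t)),
    (Im l * (exp s * cos t) + Re l * (exp s * sin t)).
  split; eapply differentiable_pt_lim_eq.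
  - apply (differentiable_pt_lim_comp _ _ _ _ _ _ _ _ _ _ _ H1 P1 P2).
  - reflexivity.
  - ring.
  - apply (differentiable_pt_lim_comp _ _ _ _ _ _ _ _ _ _ _ H2 P1 P2).
  - reflexivity.
  - ring.
Qed.

(** This includes [r = 0], which logarithmic coordinates do not reach and where the limits of the
    means are taken. *)
Lemma polar_continuity f r t :
  holomorphic_on_disk f -> Cmod (polar r t) < 1 ->
  continuity_2d_pt (fun x y => Re (f (polar x y))) r t /\
  continuity_2d_pt (fun x y => Im (f (polar x y))) r t.
Proof.
  intros Hf Hr. destruct (Hf (polar r t) Hr) as [l Hl].
  apply is_derive_C_differentiable in Hl. destruct Hl as [H1 H2].
  apply differentiable_pt_lim_continuity in H1. apply differentiable_pt_lim_continuity in H2.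
  assert (P : forall g, continuity_pt g t -> continuity_2d_pt (fun x y => x * g y) r t).
  { intros g Hg. apply continuity_2d_pt_mult. apply continuity_2d_pt_id1.
    apply (continuity_1d_2d_pt_comp g); auto. apply continuity_2d_pt_id2. }
  assert (Comp : forall F, continuity_2d_pt F (r * cos t) (r * sin t) ->
    continuity_2d_pt (fun x y => F (x * cos y) (x * sin y)) r t).
  { intros F HF eps. destruct (HF eps) as [d Hd].
    destruct (P cos (continuity_cos t) d) as [d1 Hd1].
    destruct (P sin (continuity_sin t) d) as [d2 Hd2].
    assert (Hm : 0 < Rmin d1 d2) by (apply Rmin_glb_lt; apply cond_pos).
    exists (mkposreal _ Hm). simpl. intros u v Hu Hv.
    pose proof (Rmin_l d1 d2). pose proof (Rmin_r d1 d2).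
    apply Hd; [apply Hd1 | apply Hd2]; lra. }
  split; [exact (Comp _ H1) | exact (Comp _ H2)].
Qed.

Lemma polar_period r : polar r 0 = polar r (2 * PI).
Proof. unfold polar. now rewrite cos_0, sin_0, cos_2PI, sin_2PI. Qed.

Lemma polar_0 t : polar 0 t = RtoC 0.
Proof. unfold polar, RtoC. now rewrite !Rmult_0_l. Qed.

Lemma log_bounded (F : R -> R -> R) :
  continuity_2d_pt F 0 0 ->
  bounded_at_minus_infinity (fun s t => F (exp s * cos t) (exp s * sin t)).
Proof.
  intros HF. destruct (HF (mkposreal 1 Rlt_0_1)) as [d Hd]. simpl in Hd.
  (* For [s < ln d] the point [exp (s + i t)] lies within [d] of the origin, where [F] is within 1
     of [F 0 0]. *)
  exists (ln d), (Rabs (F 0 0) + 1). intros s t Hs.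
  assert (Es : 0 < exp s < d).
  { split. apply exp_pos. rewrite <- (exp_ln d) by apply cond_pos. now apply exp_increasing. }
  assert (B : forall c, -1 <= c <= 1 -> Rabs (exp s * c - 0) < d).
  { intros c Hc. apply Rabs_lt_between. nra. }
  specialize (Hd _ _ (B _ (COS_bound t)) (B _ (SIN_bound t))).
  pose proof (Rabs_triang_inv (F (exp s * cos t) (exp s * sin t)) (F 0 0)). lra.
Qed.

Lemma log_log_holomorphic f :
  holomorphic_on_disk f -> exists U' V', log_holomorphic (log_re f) (log_im f) U' V'.
Proof.
  intros Hf.
  exists (fun s t => Derive (fun x => log_re f x t) s), (fun s t => Derive (fun x => log_im f x t) s).
  split; [|split; split].
  - intros s t Hs. destruct (log_differentiable f s t Hf Hs) as (p & q & H1 & H2).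
    destruct (differentiable_pt_lim_unique _ _ _ _ _ H1) as [-> _].
    destruct (differentiable_pt_lim_unique _ _ _ _ _ H2) as [-> _]. auto.
  - intros s _. unfold log_re. now rewrite polar_period.
  - intros s _. unfold log_im. now rewrite polar_period.
  - destruct (Hf (0, 0)) as [l Hl]. { change (Cmod (RtoC 0) < 1). rewrite Cmod_0. lra. }
    apply is_derive_C_differentiable in Hl.
    apply (log_bounded (fun u v => Re (f (u, v)))).
    eapply differentiable_pt_lim_continuity. apply Hl.
  - destruct (Hf (0, 0)) as [l Hl]. { change (Cmod (RtoC 0) < 1). rewrite Cmod_0. lra. }
    apply is_derive_C_differentiable in Hl.
    apply (log_bounded (fun u v => Im (f (u, v)))).
    eapply differentiable_pt_lim_continuity. apply Hl.
Qed.

(** * Circle means on the disk, down to radius 0 *)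

Definition disk_energy (f : C -> C) (a b k r t : R) : R :=
  powR (a * Re (f (polar r t)) ^ 2 + b * Im (f (polar r t)) ^ 2) k.

Definition disk_mean (f : C -> C) (a b k r : R) : R :=
  RInt (disk_energy f a b k r) 0 (2 * PI).

Lemma disk_energy_continuity f a b k r t :
  holomorphic_on_disk f -> 0 <= a -> 0 <= b -> 0 < k -> 0 <= r < 1 ->
  continuity_2d_pt (disk_energy f a b k) r t.
Proof.
  intros Hf Ha Hb Hk Hr. destruct (polar_continuity f r t Hf) as [C1 C2].
  { rewrite Cmod_polar; lra. }
  apply (continuity_1d_2d_pt_comp (fun z => powR z k)
    (fun r t => a * Re (f (polar r t)) ^ 2 + b * Im (f (polar r t)) ^ 2)).
  - apply continuity_pt_powR; auto. nra.
  - continuity_2d.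
Qed.

Lemma disk_energy_ex_RInt f a b k r :
  holomorphic_on_disk f -> 0 <= a -> 0 <= b -> 0 < k -> 0 <= r < 1 ->
  ex_RInt (disk_energy f a b k r) 0 (2 * PI).
Proof.
  intros. apply (ex_RInt_half_plane_2 (disk_energy f a b k)).
  intros t. now apply disk_energy_continuity.
Qed.

Lemma powR_nonneg x k : 0 <= powR x k.
Proof. unfold powR. destruct (Rle_dec x 0). lra. left; apply exp_pos. Qed.

Lemma powR_0 k : powR 0 k = 0.
Proof. unfold powR. destruct (Rle_dec 0 0); lra. Qed.

Lemma disk_mean_0 f a b k : f (RtoC 0) = RtoC 0 -> disk_mean f a b k 0 = 0.
Proof.
  intros H0. unfold disk_mean.
  rewrite (RInt_ext _ (fun _ => 0)).
  - rewrite RInt_const. apply Rmult_0_r.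
  - intros t _. unfold disk_energy. rewrite polar_0, H0. simpl.
    replace (_ + _) with 0 by ring. apply powR_0.
Qed.

Lemma disk_mean_nonneg f a b k r :
  holomorphic_on_disk f -> 0 <= a -> 0 <= b -> 0 < k -> 0 <= r < 1 ->
  0 <= disk_mean f a b k r.
Proof.
  intros. apply RInt_ge_0. pose proof PI_RGT_0; lra.
  now apply disk_energy_ex_RInt. intros; apply powR_nonneg.
Qed.

Lemma disk_mean_limit f a b k :
  holomorphic_on_disk f -> f (RtoC 0) = RtoC 0 -> 0 <= a -> 0 <= b -> 0 < k ->
  limit1_in (disk_mean f a b k) (fun r => 0 < r) 0 0.
Proof.
  intros Hf H0 Ha Hb Hk. rewrite <- (disk_mean_0 f a b k H0) at 1.
  apply (RInt_limit (disk_energy f a b k) 0 (2 * PI) 1); try lra.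
  - pose proof PI_RGT_0; lra.
  - intros t _. apply disk_energy_continuity; auto; lra.
  - intros x Hx. apply disk_energy_ex_RInt; auto; lra.
Qed.

Lemma disk_mean_log f a b k r :
  0 < r -> disk_mean f a b k r = circle_int (energy a b k (log_re f) (log_im f)) (ln r).
Proof.
  intros Hr. unfold disk_mean, circle_int. apply RInt_ext. intros t _.
  unfold disk_energy, energy, log_re, log_im. now rewrite exp_ln.
Qed.

Lemma ln_neg r : 0 < r < 1 -> ln r < 0.
Proof. intros. rewrite <- ln_1. apply ln_increasing; lra. Qed.

Lemma disk_mean_nondecreasing f a b k r1 r2 :
  holomorphic_on_disk f -> f (RtoC 0) = RtoC 0 -> 0 <= a -> 0 <= b -> 1 <= k ->
  0 <= r1 <= r2 -> r2 < 1 -> disk_mean f a b k r1 <= disk_mean f a b k r2.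
Proof.
  intros Hf H0 Ha Hb Hk H12 H2. destruct (proj1 H12) as [Hp | <-].
  - destruct (log_log_holomorphic f Hf) as (U' & V' & HH).
    rewrite !disk_mean_log by lra. apply (energy_nondecreasing _ _ U' V'); auto.
    + apply ln_le; lra.
    + apply ln_neg; lra.
  - rewrite disk_mean_0 by auto. apply disk_mean_nonneg; auto; lra.
Qed.

Definition disk_gap (f : C -> C) (k r : R) : R :=
  2 * k / (2 * k - 1) * disk_mean f 1 0 k r + 2 * k / (2 * k - 1) * disk_mean f 0 1 k r
  + (-1) * disk_mean f 1 1 k r.

Lemma disk_gap_log f k r :
  0 < r -> disk_gap f k r = riesz_gap k (log_re f) (log_im f) (ln r).
Proof.
  intros Hr. unfold disk_gap, riesz_gap. rewrite !disk_mean_log by auto. ring.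
Qed.

Lemma disk_gap_limit f k :
  holomorphic_on_disk f -> f (RtoC 0) = RtoC 0 -> 1 <= k ->
  limit1_in (disk_gap f k) (fun r => 0 < r) 0 0.
Proof.
  intros Hf H0 Hk. set (c := 2 * k / (2 * k - 1)).
  assert (L : forall a b, 0 <= a -> 0 <= b -> limit1_in (disk_mean f a b k) (fun r => 0 < r) 0 0)
    by (intros; apply disk_mean_limit; auto; lra).
  pose proof (limit1_in_lincomb _ _ _ _ _ _ c c (L 1 0 ltac:(lra) ltac:(lra))
    (L 0 1 ltac:(lra) ltac:(lra))) as L1.
  pose proof (limit1_in_lincomb _ _ _ _ _ _ 1 (-1) L1 (L 1 1 ltac:(lra) ltac:(lra))) as L2.
  replace (1 * (c * 0 + c * 0) + -1 * 0) with 0 in L2 by ring.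
  intros eps Heps. destruct (L2 eps Heps) as (d & Hd & H). exists d. split; auto.
  intros x Hx. specialize (H x Hx). simpl in *. unfold disk_gap. fold c.
  rewrite Rmult_1_l in H. exact H.
Qed.

Lemma limit1_in_const (c : R) D x : limit1_in (fun _ => c) D c x.
Proof. exact (limit_free (fun _ => c) D 0 x). Qed.

Lemma disk_gap_0 f k : f (RtoC 0) = RtoC 0 -> disk_gap f k 0 = 0.
Proof. intros H0. unfold disk_gap. rewrite !disk_mean_0 by auto. ring. Qed.

(** For [0 < x < r] the gap at [x] is at most the gap at [r]; letting [x] tend to 0 bounds the
    latter below by 0. The radius 0 has no logarithm and is treated by itself. *)
Lemma disk_gap_nonneg f k r :
  holomorphic_on_disk f -> f (RtoC 0) = RtoC 0 -> 1 <= k <= 2 -> 0 <= r < 1 ->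
  0 <= disk_gap f k r.
Proof.
  intros Hf H0 Hk Hr. destruct (proj1 Hr) as [Hp | <-]; [| rewrite disk_gap_0; auto; lra].
  destruct (log_log_holomorphic f Hf) as (U' & V' & HH).
  apply (limit1_in_le _ _ _ _ r Hp (disk_gap_limit f k Hf H0 ltac:(lra)) (limit1_in_const _ _ _)).
  intros x Hx. rewrite !disk_gap_log by lra.
  apply (riesz_gap_nondecreasing _ _ U' V'); auto.
  - apply ln_le; lra.
  - apply ln_neg; lra.
Qed.

Lemma disk_gap_nonpos f k r :
  holomorphic_on_disk f -> f (RtoC 0) = RtoC 0 -> 2 <= k -> 0 <= r < 1 ->
  disk_gap f k r <= 0.
Proof.
  intros Hf H0 Hk Hr. destruct (proj1 Hr) as [Hp | <-]; [| rewrite disk_gap_0; auto; lra].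
  destruct (log_log_holomorphic f Hf) as (U' & V' & HH).
  apply (limit1_in_le _ _ _ _ r Hp (limit1_in_const _ _ _) (disk_gap_limit f k Hf H0 ltac:(lra))).
  intros x Hx. rewrite !disk_gap_log by lra.
  apply (riesz_gap_nonincreasing _ _ U' V'); auto.
  - apply ln_le; lra.
  - apply ln_neg; lra.
Qed.

(** * From circle means to Hardy norms *)

Lemma powR_le x y k : 0 <= k -> x <= y -> powR x k <= powR y k.
Proof.
  intros Hk Hxy. unfold powR. destruct (Rle_dec x 0), (Rle_dec y 0); try lra.
  - left; apply exp_pos.
  - apply Rpower_le_nonneg; lra.
Qed.

Lemma powR_powR x a b : 0 <= x -> powR (powR x a) b = powR x (a * b).
Proof.
  intros [Hx | <-]; [| now rewrite !powR_0].
  rewrite (powR_Rpower x a), (powR_Rpower x), powR_Rpower by (auto; apply exp_pos).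
  apply Rpower_mult.
Qed.

Lemma powR_1 x : 0 <= x -> powR x 1 = x.
Proof. intros [Hx | <-]; [| apply powR_0]. rewrite powR_Rpower by auto. now apply Rpower_1. Qed.

Lemma powR_mult x y k : 0 <= x -> 0 <= y -> powR (x * y) k = powR x k * powR y k.
Proof.
  intros [Hx | <-]; [| intros; rewrite Rmult_0_l, powR_0; ring].
  intros [Hy | <-]; [| rewrite Rmult_0_r, powR_0; ring].
  rewrite !powR_Rpower by (try apply Rmult_lt_0_compat; auto).
  symmetry. now apply Rpower_mult_distr.
Qed.

Lemma powR_sqr x p : 0 <= x -> powR x p = powR (x ^ 2) (p / 2).
Proof.
  intros [Hx | <-]; [| simpl; now rewrite Rmult_0_l, !powR_0].
  rewrite !powR_Rpower by nra.
  rewrite <- (Rpower_pow 2) by auto. rewrite Rpower_mult. f_equal. simpl. field.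
Qed.

Lemma integral_mean_disk p f a b g r :
  0 < p -> (forall z, Cmod (g z) ^ 2 = a * Re (f z) ^ 2 + b * Im (f z) ^ 2) ->
  integral_mean p g r = powR (/ (2 * PI) * disk_mean f a b (p / 2) r) (1 / p).
Proof.
  intros Hp Hg. unfold integral_mean, disk_mean. do 2 f_equal. apply RInt_ext.
  intros t _. unfold disk_energy. rewrite powR_sqr by apply Cmod_ge_0. now rewrite Hg.
Qed.

Lemma hp_norm_lub p g m :
  (forall r, 0 <= r < 1 -> integral_mean p g r = powR (m r) (1 / p)) ->
  is_lub_Rbar (fun x => exists r, 0 <= r < 1 /\ x = powR (m r) (1 / p)) (hp_norm p g).
Proof.
  intros H. pose proof (Lub_Rbar_correct (fun x => exists r, 0 <= r < 1 /\ x = integral_mean p g r))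
    as [H1 H2].
  split.
  - intros x (r & Hr & ->). apply H1. exists r. split; auto. symmetry. auto.
  - intros b Hb. apply H2. intros x (r & Hr & ->). apply Hb. exists r. auto.
Qed.

(** The form of [hp_norm] with the integral mean abstracted to [m], so that comparing norms becomes
    a matter of suprema. The root stays inside the supremum; [power_lub_finite] and
    [power_lub_least] carry the [p]-th power across it. *)
Definition power_lub (p : R) (m : R -> R) (N : Rbar) : Prop :=
  is_lub_Rbar (fun x => exists r, 0 <= r < 1 /\ x = powR (m r) (1 / p)) N.

Lemma powR_root x p : p <> 0 -> 0 <= x -> powR (powR x (1 / p)) p = x.
Proof.
  intros Hp Hx. rewrite powR_powR by auto. replace (1 / p * p) with 1 by (field; auto).
  now apply powR_1.
Qed.

Lemma power_lub_finite p m n r :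
  0 < p -> power_lub p m (Finite n) -> 0 <= r < 1 -> 0 <= m r -> m r <= powR n p.
Proof.
  intros Hp [H _] Hr Hm. rewrite <- (powR_root (m r) p) by lra.
  apply powR_le; [lra|]. apply (H (powR (m r) (1 / p))). now exists r.
Qed.

Lemma power_lub_least p m n K :
  0 < p -> power_lub p m (Finite n) -> 0 <= K -> (forall r, 0 <= r < 1 -> m r <= K) ->
  powR n p <= K.
Proof.
  intros Hp [_ H] HK Hm. rewrite <- (powR_root K p) by lra. apply powR_le; [lra|].
  apply (H (Finite (powR K (1 / p)))). intros x (r & Hr & ->). simpl.
  apply powR_le; auto. left. apply Rdiv_lt_0_compat; lra.
Qed.

Lemma power_lub_nonneg p m N : power_lub p m N -> Rbar_le (Finite 0) N.
Proof.
  intros [H _]. apply Rbar_le_trans with (Finite (powR (m 0) (1 / p))).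
  - simpl. apply powR_nonneg.
  - apply H. exists 0. split; auto. lra.
Qed.

(** At each radius [mu] and [mv] are bounded by the powers of their own suprema, so the inequality
    passes radius by radius. If [Nu] or [Nv] is infinite, so is the right-hand side, the factor
    [powR c (1 / p)] being positive. *)
Lemma power_lub_upper p mf mu mv Nf Nu Nv c :
  0 < p -> 0 < c ->
  power_lub p mf Nf -> power_lub p mu Nu -> power_lub p mv Nv ->
  (forall r, 0 <= r < 1 -> 0 <= mu r /\ 0 <= mv r /\ mf r <= c * (mu r + mv r)) ->
  Rbar_le Nf (Rbar_mult (Finite (powR c (1 / p)))
    (Rbar_powR (Rbar_plus (Rbar_powR Nu p) (Rbar_powR Nv p)) (1 / p))).
Proof.
  intros Hp Hc Lf Lu Lv H.
  assert (Hcp : 0 < powR c (1 / p)) by (rewrite powR_Rpower by auto; apply exp_pos).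
  assert (Inf : Rbar_mult (Finite (powR c (1 / p))) p_infty = p_infty).
  { simpl. destruct (Rle_dec 0 (powR c (1 / p))) as [Hle|]; [|lra].
    destruct (Rle_lt_or_eq_dec 0 (powR c (1 / p)) Hle); auto. lra. }
  pose proof (power_lub_nonneg _ _ _ Lu) as Zu. pose proof (power_lub_nonneg _ _ _ Lv) as Zv.
  destruct Nu as [nu | |], Nv as [nv | |]; try (now destruct Zu); try (now destruct Zv);
    cbn [Rbar_powR Rbar_plus Rbar_plus']; try (rewrite Inf; now destruct Nf).
  apply (proj2 Lf). intros x (r & Hr & ->). simpl. destruct (H r Hr) as (H1 & H2 & H3).
  pose proof (power_lub_finite p mu nu r Hp Lu Hr H1).
  pose proof (power_lub_finite p mv nv r Hp Lv Hr H2).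
  rewrite <- powR_mult by lra. apply powR_le.
  - left. apply Rdiv_lt_0_compat; lra.
  - eapply Rle_trans. exact H3. apply Rmult_le_compat_l; lra.
Qed.

(** The hypothesis bounds [mu] and [mv] at the same radius, whereas the conclusion involves their
    suprema separately. Monotonicity decouples the radii, after which the supremum is taken over one
    radius and then over the other. The bound also forces [Nu] and [Nv] to be finite. *)
Lemma power_lub_lower p mf mu mv nf Nu Nv c :
  0 < p -> 1 <= c ->
  power_lub p mf (Finite nf) -> power_lub p mu Nu -> power_lub p mv Nv ->
  (forall r, 0 <= r < 1 -> 0 <= mu r /\ 0 <= mv r /\ c * (mu r + mv r) <= mf r) ->
  (forall r1 r2, 0 <= r1 <= r2 -> r2 < 1 -> mu r1 <= mu r2 /\ mv r1 <= mv r2) ->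
  Rbar_le (Rbar_mult (Finite (powR c (1 / p)))
    (Rbar_powR (Rbar_plus (Rbar_powR Nu p) (Rbar_powR Nv p)) (1 / p))) (Finite nf).
Proof.
  intros Hp Hc Lf Lu Lv H Hmon.
  assert (Hip : 0 <= 1 / p) by (left; apply Rdiv_lt_0_compat; lra).
  assert (Hnf : 0 <= nf) by exact (power_lub_nonneg _ _ _ Lf).
  assert (B : forall r, 0 <= r < 1 -> c * (mu r + mv r) <= powR nf p).
  { intros r Hr. destruct (H r Hr) as (H1 & H2 & H3). eapply Rle_trans. exact H3.
    apply (power_lub_finite p mf nf r Hp Lf Hr). nra. }
  set (K := powR nf p) in *.
  (* Both means are evaluated at the larger radius, which can only increase them. *)
  assert (B2 : forall r1 r2, 0 <= r1 < 1 -> 0 <= r2 < 1 -> mu r1 + mv r2 <= K / c).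
  { intros r1 r2 H1 H2. apply (Rmult_le_reg_l c); [lra|].
    replace (c * (K / c)) with K by (field; lra).
    destruct (Rle_dec r1 r2) as [Hle | Hgt].
    - destruct (Hmon r1 r2) as [M _]; try lra. specialize (B r2 H2). nra.
    - destruct (Hmon r2 r1) as [_ M]; try lra. specialize (B r1 H1). nra. }
  assert (Fin : forall m N, power_lub p m N -> (forall r, 0 <= r < 1 -> m r <= K / c) ->
     exists n, N = Finite n).
  { intros m N L Hm. pose proof (power_lub_nonneg _ _ _ L) as Z.
    assert (U : Rbar_le N (Finite (powR (K / c) (1 / p)))).
    { apply (proj2 L). intros x (r & Hr & ->). simpl. apply powR_le; auto. }
    destruct N as [n | |]; [now exists n | destruct U | destruct Z]. }
  destruct (Fin mu Nu Lu) as [nu ->].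
  { intros r Hr. destruct (H r Hr) as (_ & Z & _). specialize (B2 r r Hr Hr). lra. }
  destruct (Fin mv Nv Lv) as [nv ->].
  { intros r Hr. destruct (H r Hr) as (Z & _ & _). specialize (B2 r r Hr Hr). lra. }
  (* Radius 0 serves as a sample point showing that the bounds [K / c - mv r] and
     [K / c - powR nu p] are nonnegative, as [power_lub_least] requires. *)
  assert (H00 : 0 <= 0 < 1) by lra.
  assert (Ku : forall r, 0 <= r < 1 -> powR nu p <= K / c - mv r).
  { intros r Hr. apply (power_lub_least p mu); auto.
    - specialize (B2 0 r H00 Hr). destruct (H 0 H00) as (Z & _). lra.
    - intros r1 Hr1. specialize (B2 r1 r Hr1 Hr). lra. }
  assert (Kv : powR nv p <= K / c - powR nu p).
  { apply (power_lub_least p mv); auto.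
    - specialize (Ku 0 H00). destruct (H 0 H00) as (_ & Z & _). lra.
    - intros r Hr. specialize (Ku r Hr). lra. }
  cbn [Rbar_powR Rbar_plus Rbar_plus' Rbar_mult Rbar_mult' Rbar_le].
  pose proof (powR_nonneg nu p). pose proof (powR_nonneg nv p).
  rewrite <- powR_mult by lra.
  replace nf with (powR K (1 / p)).
  - apply powR_le; auto. replace K with (c * (K / c)) by (field; lra).
    apply Rmult_le_compat_l; lra.
  - unfold K. rewrite powR_powR by auto. replace (p * (1 / p)) with 1 by (field; lra).
    now apply powR_1.
Qed.

Theorem theorem1p4 :
  forall (p : R) (f : C -> C),
    2 <= p ->
    Hardy p f ->
    f (RtoC 0) = RtoC 0 ->
    let u : C -> C := fun z => RtoC (Re (f z)) in
    let v : C -> C := fun z => RtoC (Im (f z)) in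
    let bound : Rbar :=
      Rbar_mult (Finite (powR (p / (p - 1)) (1 / p)))
        (Rbar_powR
           (Rbar_plus (Rbar_powR (hp_norm p u) p) (Rbar_powR (hp_norm p v) p))
           (1 / p)) in
    (p <= 4 -> Rbar_le (hp_norm p f) bound) /\
    (4 <= p -> Rbar_le bound (hp_norm p f)).
Proof.
  intros p f Hp [Hf HN] H0 u v bound.
  (* The squared moduli of [f], [u] and [v] are the forms with coefficients (1, 1), (1, 0) and (0,
     1), so one family covers the three norms, with exponent [p / 2] on squares. *)
  set (m := fun a b r => / (2 * PI) * disk_mean f a b (p / 2) r).
  assert (Hpi : 0 < / (2 * PI)) by (apply Rinv_0_lt_compat; pose proof PI_RGT_0; lra).
  assert (Lf : power_lub p (m 1 1) (hp_norm p f)).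
  { apply hp_norm_lub. intros r _. apply integral_mean_disk; [lra|].
    intros z. unfold Cmod. rewrite pow2_sqrt by (simpl; nra). unfold Re, Im. ring. }
  assert (Lu : power_lub p (m 1 0) (hp_norm p u)).
  { apply hp_norm_lub. intros r _. apply integral_mean_disk; [lra|].
    intros z. unfold u. rewrite Cmod_R, pow2_abs. ring. }
  assert (Lv : power_lub p (m 0 1) (hp_norm p v)).
  { apply hp_norm_lub. intros r _. apply integral_mean_disk; [lra|].
    intros z. unfold v. rewrite Cmod_R, pow2_abs. ring. }
  assert (Pos : forall a b r, 0 <= a -> 0 <= b -> 0 <= r < 1 -> 0 <= m a b r).
  { intros. apply Rmult_le_pos; [lra|]. apply disk_mean_nonneg; auto; lra. }
  assert (Hc : 1 <= p / (p - 1)).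
  { apply (Rmult_le_reg_r (p - 1)); [lra|]. replace (p / (p - 1) * (p - 1)) with p by (field; lra). lra. }
  assert (Gap : forall r, / (2 * PI) * disk_gap f (p / 2) r =
     p / (p - 1) * (m 1 0 r + m 0 1 r) - m 1 1 r).
  { intros r. unfold disk_gap, m. replace (2 * (p / 2)) with p by field. ring. }
  unfold bound. split; intros H4.
  - apply (power_lub_upper p (m 1 1) (m 1 0) (m 0 1)); auto; try lra.
    intros r Hr. repeat split; try (apply Pos; auto; lra).
    pose proof (disk_gap_nonneg f (p / 2) r Hf H0 ltac:(lra) Hr). specialize (Gap r). nra.
  - pose proof (power_lub_nonneg _ _ _ Lf) as Z.
    (* Membership in the Hardy class excludes [p_infty], nonnegativity excludes [m_infty]. *)
    destruct (hp_norm p f) as [nf | |]; [| destruct HN | destruct Z].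
    apply (power_lub_lower p (m 1 1) (m 1 0) (m 0 1)); auto; try lra.
    + intros r Hr. repeat split; try (apply Pos; auto; lra).
      pose proof (disk_gap_nonpos f (p / 2) r Hf H0 ltac:(lra) Hr). specialize (Gap r). nra.
    + intros r1 r2 H12 H2. unfold m.
      split; apply Rmult_le_compat_l; try lra; apply disk_mean_nondecreasing; auto; lra.
Qed.
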